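(* There exists a finitely generated group $\Gamma$ whose normal subgroup growth and characteristic subgroup growth are of different types; that is, there is no positive real-valued function $f(n)$ on the positive integers such that both $s_n^{\lhd}(\Gamma)$ and $s_n^{\mathrm{ch}}(\Gamma)$ have growth type $f(n)$.
   Context: For a finitely generated group $\Gamma$, $s_n^{\lhd}(\Gamma)$ denotes the number of normal subgroups of $\Gamma$ of index at most $n$, and $s_n^{\mathrm{ch}}(\Gamma)$ denotes the number of characteristic subgroups of $\Gamma$ of index at most $n$ (a subgroup is characteristic if it is preserved by every automorphism of $\Gamma$). A function $g(n)$ on positive integers has growth type $f(n)$ if there are constants $a, b > 0$ such that $g(n) \leq f(n)^a$ for every $n$ and $g(n) \geq f(n)^b$ for infinitely many $n$. The group $\Gamma$ has normal (respectively characteristic) subgroup growth of type $f(n)$ if $s_n^{\lhd}(\Gamma)$ (respectively $s_n^{\mathrm{ch}}(\Gamma)$) has growth type $f(n)$. *)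

(* Defs.v *)
From mathcomp Require Import all_boot all_order all_algebra.
From mathcomp Require Import finmap.
From mathcomp Require Import all_classical all_reals exp.

Set Implicit Arguments.
Unset Strict Implicit.
Unset Printing Implicit Defensive.

Import Order.TTheory GRing.Theory Num.Theory.

Local Open Scope classical_set_scope.
Local Open Scope card_scope.

Section SubgroupGrowth.
Variable G : groupType.
Implicit Types H : set G.

Definition is_subgroup H := group_closed (mem H).

Definition finitely_generated :=
  exists2 S : set G, finite_set S & smallest is_subgroup S = setT.

Definition is_normal_subgroup H :=
  is_subgroup H /\ forall x y : G, H x -> H (x ^ y)%g.

Definition is_characteristic_subgroup H :=
  is_subgroup H /\
  forall phi : {multiplicative G -> G}, bijective phi -> phi @` H = H.

Definition lcosets_of H : set (set G) :=
  [set [set (x * h)%g | h in H] | x in [set: G]].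

Definition index_at_most H (n : nat) := lcosets_of H #<= `I_n.

(* [fset_set] is the empty set on infinite arguments; the two counts below are
   meant for a finitely generated G, which has only finitely many subgroups of
   index at most n. *)
Definition normal_growth (n : nat) : nat :=
  #|` fset_set [set H | is_normal_subgroup H /\ index_at_most H n]|.

Definition characteristic_growth (n : nat) : nat :=
  #|` fset_set [set H | is_characteristic_subgroup H /\ index_at_most H n]|.

End SubgroupGrowth.

(* Functions on the positive integers are encoded as functions on nat whose
   value at 0 is irrelevant. *)
Definition has_growth_type (R : realType) (g f : nat -> R) :=
  exists a b : R, [/\ (0 < a)%R, (0 < b)%R,
    forall n, (0 < n)%N -> (g n <= f n `^ a)%R &
    infinite_set [set n | (0 < n)%N /\ (f n `^ b <= g n)%R]].

(* Main.v *)
Require Import Defs.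
From HB Require Import structures.
From mathcomp Require Import all_boot all_order all_algebra.
From mathcomp Require Import all_fingroup all_solvable finmap zify.
From mathcomp Require Import all_classical all_reals exp.

(** The group [gamma] constructed below has many normal subgroups of finite index,
    but its automorphisms permute them so strongly that few are characteristic.

    Let [A5] be the alternating group of degree 5, acting on five letters, and let
    [branchG] be the group of automorphisms of the rooted tree of words generated
    by a rooted and a directed copy of [A5]. It is perfect and contains a copy of
    itself below each letter, which forces its nontrivial normal subgroups to be
    the stabilizers of the levels ([normal_level_stabilizer]): these are few.

    Attach to every word [v] a layer, consisting of labels in [A5] at the words of
    the same length as [v], and let [branchG] act on every layer by moving words.
    Add to [branchG] the elements that put one and the same label at the word [v]
    of the layer of [v], for all [v]. The resulting group [gamma] is finitely
    generated. Since the marked word depends on the layer, commutators isolate each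
    layer, and [gamma] contains all labellings with finite support
    ([decoG_lab_finite]). Two consequences follow.

    An exchange of two layers of the same level changes only finitely many labels
    of any given element, hence preserves [gamma]: the layers of a level are
    permuted by automorphisms ([swap_aut]).

    A normal subgroup [N] of finite index contains an element of [branchG] that
    moves all long words ([normal_mover]). Commutators with it show that, modulo
    [N], the labels reduce to those in the layers that [N] does not contain, and
    [N] centralizes these layers. So [N] is determined by the set of layers that it
    contains and by its image in [branchG] ([normal_determined]). Each missing layer
    of level [l] makes the index at least 2 ^ (5 ^ l) ([layer_index]).

    Now let n lie between 2 ^ (25 ^ (i + 1)) and 2 ^ (25 ^ (i + 2)). A characteristic
    subgroup of index at most n misses either all or none of the layers of a level,
    and only O(i) levels are concerned, so there are at most 2 ^ (8 (i + 2)) such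
    subgroups ([characteristic_growth_upper]). A normal subgroup may miss any of the
    5 ^ i layers of level [i] independently, and there are at least 2 ^ (5 ^ i) of
    them ([normal_growth_lower]). Thus the normal growth eventually exceeds every
    power of the characteristic growth ([growth_gap]), which two functions of the
    same type do not allow ([growth_type_gap]). *)

Set Implicit Arguments.
Unset Strict Implicit.
Unset Printing Implicit Defensive.

Local Open Scope group_scope.

(** * Subgroups of an arbitrary group *)

Section Subgroups.
Variable G : groupType.
Implicit Types H : set G.

Lemma subgroup1 H : is_subgroup H -> H 1.
Proof. by case=> /set_mem. Qed.

Lemma subgroupF H x y : is_subgroup H -> H x -> H y -> H (x * y^-1).
Proof.
by case=> _ HF Hx Hy; apply/set_mem/HF; apply/mem_set.
Qed.

Lemma subgroupV H x : is_subgroup H -> H x -> H x^-1.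
Proof.
by move=> sH Hx; rewrite -div1g; apply: subgroupF => //; apply: subgroup1.
Qed.

Lemma subgroupM H x y : is_subgroup H -> H x -> H y -> H (x * y).
Proof.
by move=> sH Hx Hy; rewrite -[y]invgK; apply: subgroupF => //; apply: subgroupV.
Qed.

Lemma subgroupR H x y : is_subgroup H -> H x -> H y -> H [~ x, y].
Proof.
move=> sH Hx Hy; rewrite /commg /conjg.
by do ![apply: subgroupM => //]; apply: subgroupV.
Qed.

Lemma subgroupJ H x y : is_subgroup H -> H x -> H y -> H (x ^ y).
Proof.
by move=> sH Hx Hy; rewrite conjgE; do ![apply: subgroupM => //]; apply: subgroupV.
Qed.

Lemma subgroupI H : H 1 -> (forall x y, H x -> H y -> H (x * y)) ->
  (forall x, H x -> H x^-1) -> is_subgroup H.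
Proof.
move=> H1 HM HV; split; first exact/mem_set.
by move=> x y /set_mem Hx /set_mem Hy; apply/mem_set/HM => //; apply: HV.
Qed.

Lemma generated_subgroup (S : set G) : is_subgroup (smallest (@is_subgroup G) S).
Proof.
split=> [|x y /set_mem Sx /set_mem Sy]; apply/mem_set => H [sH SH].
  exact: subgroup1.
by apply: subgroupF => //; [apply: Sx | apply: Sy].
Qed.

Definition normal_in (L K : set G) :=
  [/\ is_subgroup K, (K `<=` L)%classic & forall x y, K x -> L y -> K (x ^ y)].

Lemma normal_in_comm L K x y : normal_in L K -> K x -> L y -> K [~ x, y].
Proof.
move=> [sK _ nK] Kx Ly.
exact: (subgroupM sK (subgroupV sK Kx) (nK _ _ Kx Ly)).
Qed.

Lemma normal_in_mul L M K : is_subgroup L -> normal_in L M -> normal_in L K ->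
  normal_in L [set x | exists a b, [/\ M a, K b & x = a * b]]%classic.
Proof.
move=> sL [sM ML nM] [sK KL nK]; split=> [|_ [a [b [/ML La /KL Lb ->]]]|].
- apply: subgroupI => [|_ _ [a [b [Ma Kb ->]]] [c [d [Mc Kd ->]]]|_ [a [b [Ma Kb ->]]]].
  + by exists 1, 1; rewrite mulg1; split=> //; apply: subgroup1.
  + exists (a * c ^ b^-1), (b * d); split; last by rewrite conjgE invgK !mulgA mulgVK.
      by apply: subgroupM => //; apply: nM => //; apply: subgroupV => //; apply: KL.
    exact: subgroupM.
  + exists (a^-1 ^ b), b^-1; split; last by rewrite conjgE invgM !mulgA mulgK.
      by apply: nM; [apply: subgroupV | apply: KL].
    exact: subgroupV.
- exact: subgroupM.
- move=> _ y [a [b [Ma Kb ->]]] Ly; exists (a ^ y), (b ^ y).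
  by rewrite conjMg; split=> //; [apply: nM | apply: nK].
Qed.

End Subgroups.

(** * The alternating group of degree five *)

Notation letter := 'I_5.
Notation A5 := (subg_of (Alt_group letter)).

Definition lact (a : A5) (x : letter) : letter := sgval a x.

Lemma lact1 x : lact 1 x = x.
Proof. by rewrite /lact morph1 perm1. Qed.

Lemma lactM a b x : lact (a * b) x = lact b (lact a x).
Proof. by rewrite /lact morphM ?inE // permM. Qed.

Lemma lact_inj a : injective (lact a).
Proof. exact: perm_inj. Qed.

Lemma lactK a : cancel (lact a) (lact a^-1).
Proof. by move=> x; rewrite -lactM mulgV lact1. Qed.

Lemma lactKV a : cancel (lact a^-1) (lact a).
Proof. by move=> x; rewrite -lactM mulVg lact1. Qed.

Lemma lact_ext a b : lact a =1 lact b -> a = b.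
Proof. by move=> e; apply/val_inj/permP. Qed.

Lemma A5_of_even (s : {perm letter}) : ~~ odd_perm s -> exists a : A5, lact a =1 s.
Proof.
move=> es; have sA : s \in 'Alt_letter by rewrite Alt_even.
by exists (subg _ s) => x; rewrite /lact subgK.
Qed.

Lemma A5_double_tperm (x y z t : letter) : x != y -> z != t ->
  exists a : A5, lact a =1 tperm x y * tperm z t.
Proof.
by move=> xy zt; apply: A5_of_even; rewrite odd_permM !odd_tperm xy zt.
Qed.

Lemma two_more_letters (x y : letter) : exists z t : letter,
  [/\ z != t, z != x, z != y, t != x & t != y].
Proof.
have : 1 < #|~: [set x; y]|.
  by rewrite -(ltn_add2l #|[set x; y]|) cardsC card_ord cards2; case: (x != y).
move=> /card_gt1P[z [t [zx tx zt]]]; exists z, t.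
by move: zx tx; rewrite !inE !negb_or => /andP[-> ->] /andP[-> ->].
Qed.

Lemma A5_trans (x y : letter) : exists a : A5, lact a x = y.
Proof.
have [<-|xy] := eqVneq x y; first by exists 1; rewrite lact1.
have [z [_ [_ zx zy _ _]]] := two_more_letters x y.
have xz : x != z by rewrite eq_sym.
have [a ea] := A5_double_tperm xy xz.
by exists a; rewrite ea permM tpermL tpermD // eq_sym.
Qed.

Lemma A5_separates (x y : letter) : x != y ->
  exists a : A5, lact a x = x /\ lact a y != y.
Proof.
move=> xy; have [z [t [zt zx zy tx ty]]] := two_more_letters x y.
have yz : y != z by rewrite eq_sym.
have yt : y != t by rewrite eq_sym.
have [a ea] := A5_double_tperm yz yt; exists a.
rewrite !ea !permM tpermL; split; last by rewrite tpermD // eq_sym.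
by rewrite !(tpermD (y := z), tpermD (y := t)) // eq_sym.
Qed.

Lemma A5_free : exists c : A5, forall x, lact c x != x.
Proof.
(* Adding 1 modulo 5 is the square of adding 3, hence an even permutation. *)
have inj3 : injective (fun x : letter => (x + 3%:R)%R) by exact: GRing.addIr.
have [c ec] : exists c : A5, lact c =1 perm inj3 * perm inj3.
  by apply: A5_of_even; rewrite odd_permM addbb.
exists c => x; rewrite ec permM !permE -GRing.addrA.
by rewrite -[X in _ != X]GRing.addr0 (inj_eq (@GRing.addrI _ x)).
Qed.

Definition l0 : letter := inord 0.
Definition l1 : letter := inord 1.
Definition l2 : letter := inord 2.

Lemma eq_inord (m n : nat) : m < 5 -> n < 5 ->
  (inord m == inord n :> letter) = (m == n).
Proof. by move=> m5 n5; rewrite -val_eqE /= !inordK. Qed.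

(** Conjugating by this element moves the pair {0, 1} of letters to {0, 2}, which
    meets the original pair in one letter. *)
Lemma A5_fix0_1to2 : exists a : A5, lact a l0 = l0 /\ lact a l1 = l2.
Proof.
have [|| a ea] := @A5_double_tperm l1 l2 (inord 3) (inord 4); rewrite ?eq_inord //.
exists a; rewrite !ea !permM tpermL !tpermD //; by rewrite eq_inord.
Qed.

Lemma A5_noncommuting : exists a b : A5, [~ a, b] != 1.
Proof.
have [a [a0 a1]] := A5_fix0_1to2; have [b b0] := A5_trans l0 l1.
exists a, b; apply/eqP => /eqP/commgP ab.
have := lactM a b l0; rewrite ab lactM a0 b0 a1 => /eqP.
by rewrite eq_inord.
Qed.

(** Simplicity of the alternating group, for a subgroup given by a predicate; such
    predicates will pull back subgroups of infinite groups. *)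
Lemma A5_normal_full (Q : A5 -> Prop) (a : A5) :
  Q 1 -> (forall x y, Q x -> Q y -> Q (x * y)) ->
  (forall x y, Q x -> Q (x ^ y)) -> Q a -> a != 1 -> forall x, Q x.
Proof.
move=> Q1 QM QJ Qa a1 x.
have simpleA : simple [set: A5].
  rewrite -(isog_simple (isog_subg (Alt_group letter))) simple_Alt5 //.
  by rewrite card_ord.
have gQ : group_set [set x | `[< Q x >]].
  by apply/group_setP; split=> [|u v]; rewrite ?inE //; apply: QM.
have nQ : group gQ <| [set: A5].
  apply/normalP; split=> [|u _]; first exact: finset.subsetT.
  apply/setP => v; rewrite mem_conjg; apply/idP/idP; rewrite !inE; last exact: QJ.
  by move=> /(QJ _ u); rewrite conjgKV.
have /simpleP[_ /(_ _ nQ)[eQ|eQ]] := simpleA.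
  have : a \in group gQ by rewrite !inE.
  by rewrite eQ !inE => /eqP ea; rewrite ea eqxx in a1.
have : x \in group gQ by rewrite eQ !inE.
by rewrite !inE.
Qed.

(** A subgroup containing all commutators is normal, so that simplicity applies. *)
Lemma A5_perfect (Q : A5 -> Prop) :
  Q 1 -> (forall x y, Q x -> Q y -> Q (x * y)) -> (forall x y, Q [~ x, y]) ->
  forall x, Q x.
Proof.
move=> Q1 QM QR; have [a [b ab]] := A5_noncommuting.
apply: (A5_normal_full Q1 QM _ (QR a b) ab) => x y Qx.
by have -> : x ^ y = x * [~ x, y]; [rewrite commgEl mulKVg | apply: QM].
Qed.

(** Being central is a normal condition, so simplicity would make the group
    commutative. *)
Lemma A5_centerless (a : A5) : a != 1 -> exists b : A5, [~ a, b] != 1.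
Proof.
move=> a1; apply: contrapT => aZ.
have {}aZ b : commute a b.
  by apply/commgP/negPn/negP => ab; apply: aZ; exists b.
have [x [y]] := A5_noncommuting; apply/negP/negPn/commgP; apply/commute_sym.
have := @A5_normal_full (fun u => forall v, commute u v) a; apply => //.
- by move=> v; apply/commute_sym/commute1.
- by move=> u v uC vC w; apply/commute_sym/commuteM; apply/commute_sym.
- move=> u v uC w; have -> // : u ^ v = u.
  by rewrite conjgE uC mulKg.
Qed.

(** * The group of permutations of an arbitrary type *)

Record sym (X : Type) := Sym {
  sfun :> X -> X;
  sinv : X -> X;
  sfunK : cancel sfun sinv;
  sinvK : cancel sinv sfun }.

Section Sym.
Variable X : Type.
Implicit Types f g h : sym X.

Lemma sym_ext f g : f =1 g -> f = g.
Proof.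
case: f => f f' fK f'K; case: g => g g' gK g'K /= efg.
have e : f = g by apply: funext.
subst g; have e : f' = g'.
  by apply: funext => x; rewrite -{2}[x]f'K gK.
by subst g'; congr Sym; apply: Prop_irrelevance.
Qed.

HB.instance Definition _ := gen_eqMixin (sym X).
HB.instance Definition _ := gen_choiceMixin (sym X).

Definition sym_one : sym X := @Sym X id id (fun=> erefl) (fun=> erefl).
(** Products are read from left to right, as those of [perm]. *)
Definition sym_mul f g : sym X :=
  @Sym X (g \o f) (sinv f \o sinv g)
    (can_comp (@sfunK _ g) (@sfunK _ f)) (can_comp (@sinvK _ f) (@sinvK _ g)).
Definition sym_inv f : sym X := Sym (@sinvK _ f) (@sfunK _ f).

Fact sym_mulA : associative sym_mul.
Proof. by move=> f g h; apply: sym_ext. Qed.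
Fact sym_mul1 : left_id sym_one sym_mul.
Proof. by move=> f; apply: sym_ext. Qed.
Fact sym_1mul : right_id sym_one sym_mul.
Proof. by move=> f; apply: sym_ext. Qed.
Fact sym_mulV : left_inverse sym_one sym_inv sym_mul.
Proof. by move=> f; apply: sym_ext => x /=; rewrite sinvK. Qed.
Fact sym_Vmul : right_inverse sym_one sym_inv sym_mul.
Proof. by move=> f; apply: sym_ext => x /=; rewrite sfunK. Qed.

HB.instance Definition _ := isGroup.Build (sym X)
  sym_mulA sym_mul1 sym_1mul sym_mulV sym_Vmul.

Lemma symM f g x : (f * g) x = g (f x). Proof. by []. Qed.
Lemma symK f x : f^-1 (f x) = x. Proof. exact: sfunK. Qed.
Lemma symVK f x : f (f^-1 x) = x. Proof. exact: sinvK. Qed.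
Lemma symV f x y : f x = y -> f^-1 y = x. Proof. by move=> <-; rewrite symK. Qed.
Lemma sym_inj f : injective f. Proof. exact: can_inj (@sfunK _ f). Qed.

End Sym.

(** * A group of automorphisms of the five-ary tree *)

Notation word := (seq letter).

Definition rootw (a : A5) (w : word) : word :=
  if w is x :: w' then lact a x :: w' else [::].

Fact rootwK a : cancel (rootw a) (rootw a^-1).
Proof. by case=> //= x w; rewrite lactK. Qed.
Fact rootwVK a : cancel (rootw a^-1) (rootw a).
Proof. by case=> //= x w; rewrite lactKV. Qed.
Definition rooted a : sym word := Sym (rootwK a) (rootwVK a).

Fixpoint dirw (b : A5) (w : word) : word :=
  if w is x :: w' then
    x :: (if x == l0 then dirw b w' else if x == l1 then rootw b w' else w')
  else [::].

Fact dirwK b : cancel (dirw b) (dirw b^-1).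
Proof.
elim=> //= x w IH; case: eqP => _; first by rewrite IH.
by case: eqP => _ //; rewrite rootwK.
Qed.
Fact dirwVK b : cancel (dirw b^-1) (dirw b).
Proof.
elim=> //= x w IH; case: eqP => _; first by rewrite IH.
by case: eqP => _ //; rewrite rootwVK.
Qed.
Definition directed b : sym word := Sym (dirwK b) (dirwVK b).

(** A branch group in the style of P. M. Neumann and D. Segal. As the alternating
    group is perfect, this group contains a copy of itself below each letter. *)
Definition branchG : set (sym word) :=
  smallest (@is_subgroup _) (range rooted `|` range directed)%classic.

Definition belowf (s : letter -> sym word) (w : word) : word :=
  if w is x :: w' then x :: s x w' else [::].

Fact belowfK s : cancel (belowf s) (belowf (fun x => (s x)^-1)).
Proof. by case=> //= x w; rewrite sfunK. Qed.
Fact belowfVK s : cancel (belowf (fun x => (s x)^-1)) (belowf s).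
Proof. by case=> //= x w; rewrite sinvK. Qed.
Definition below s : sym word := Sym (belowfK s) (belowfVK s).

Definition at_letter x (h : sym word) := below (fun y => if y == x then h else 1).

Lemma rootedM a b : rooted (a * b) = rooted a * rooted b.
Proof. by apply: sym_ext => -[|x w] //=; rewrite lactM. Qed.
Lemma rooted1 : rooted 1 = 1.
Proof. by apply: sym_ext => -[|x w] //=; rewrite lact1. Qed.
Lemma rootedV a : rooted a^-1 = (rooted a)^-1.
Proof. exact: sym_ext. Qed.
Lemma directedM a b : directed (a * b) = directed a * directed b.
Proof.
apply: sym_ext; elim=> //= x w IH; congr (_ :: _).
case: eqP => _; first by rewrite IH.
case: eqP => _ //; exact: (congr1 (fun f : sym word => f w) (rootedM a b)).
Qed.
Lemma directed1 : directed 1 = 1.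
Proof.
by apply: (mulgI (directed 1)); rewrite -directedM !mulg1.
Qed.
Lemma directedV a : directed a^-1 = (directed a)^-1.
Proof. exact: sym_ext. Qed.

Lemma belowM s t : below s * below t = below (fun x => s x * t x).
Proof. by apply: sym_ext => -[|x w]. Qed.
Lemma belowV s : (below s)^-1 = below (fun x => (s x)^-1).
Proof. exact: sym_ext. Qed.
Lemma below1 : below (fun=> 1) = 1.
Proof. by apply: sym_ext => -[]. Qed.
Lemma below_rooted s a : rooted a * below s = below (fun x => s (lact a x)) * rooted a.
Proof. by apply: sym_ext => -[]. Qed.

Lemma directedE b : directed b =
  below (fun x => if x == l0 then directed b else if x == l1 then rooted b else 1).
Proof.
apply: sym_ext => -[|x w] //=; congr (_ :: _).
by case: eqP => //; case: eqP.
Qed.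

Lemma at_letterM x g h : at_letter x (g * h) = at_letter x g * at_letter x h.
Proof.
rewrite belowM; congr below; apply: funext => y.
by case: eqP => //; rewrite mulg1.
Qed.
Lemma at_letterV x g : at_letter x g^-1 = (at_letter x g)^-1.
Proof.
by rewrite belowV; congr below; apply: funext => y; case: eqP => //; rewrite invg1.
Qed.
Lemma at_letter1 x : at_letter x 1 = 1.
Proof. by rewrite -[RHS]below1; congr below; apply: funext => y; case: eqP. Qed.
Lemma at_letter_rooted x h a : at_letter x h ^ rooted a = at_letter (lact a x) h.
Proof.
apply: (mulgI (rooted a)); rewrite -conjgC below_rooted; congr (_ * _).
by congr below; apply: funext => y; rewrite (inj_eq (@lact_inj a)).
Qed.

Lemma branch_subgroup : is_subgroup branchG.
Proof. exact: generated_subgroup. Qed.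

Lemma branch_rooted a : branchG (rooted a).
Proof. by apply: sub_gen_smallest; left; exists a. Qed.

Lemma branch_directed b : branchG (directed b).
Proof. by apply: sub_gen_smallest; right; exists b. Qed.

Lemma branch_ind (P : set (sym word)) : is_subgroup P ->
  (forall a, P (rooted a)) -> (forall b, P (directed b)) -> forall h, branchG h -> P h.
Proof.
move=> sP PA PB h; apply: smallest_sub h => //.
by move=> _ [[a _ <-]|[b _ <-]].
Qed.

Lemma directedR b c : directed [~ b, c] = [~ directed b, directed c].
Proof. by rewrite !(directedM, directedV). Qed.

Lemma rootedR b c : rooted [~ b, c] = [~ rooted b, rooted c].
Proof. by rewrite !(rootedM, rootedV). Qed.

Lemma belowR s t : [~ below s, below t] = below (fun x => [~ s x, t x]).
Proof. by rewrite /commg /conjg !(belowV, belowM). Qed.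

Lemma below_conj_rooted s a : below s ^ rooted a = below (fun x => s (lact a^-1 x)).
Proof.
apply: (mulgI (rooted a)); rewrite -conjgC below_rooted; congr (_ * _).
by congr below; apply: funext => y; rewrite lactK.
Qed.

(** Two copies of the directed subgroup, conjugated so that their supports below
    the root share only the letter 0, have commutators supported below 0. *)
Lemma at_letter0_directed_comm b c : branchG (at_letter l0 (directed [~ b, c])).
Proof.
have [a [a0 a1]] := A5_fix0_1to2.
have -> : at_letter l0 (directed [~ b, c]) = [~ directed b, directed c ^ rooted a].
  rewrite (directedE b) (directedE c) below_conj_rooted belowR.
  congr below; apply: funext => y.
  have [->|y0] := eqVneq y l0.
    by rewrite -[in lact a^-1 l0]a0 lactK !eqxx directedR.
  have [->|y1] := eqVneq y l1; last by rewrite comm1g.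
  rewrite !ifF ?commg1 //; apply/eqP => e; have := lactKV a l1; rewrite e ?a0 ?a1 => /eqP;
    by rewrite eq_inord.
have sH := branch_subgroup; apply: (subgroupR sH) (branch_directed _) _.
exact: (subgroupJ sH (branch_directed _) (branch_rooted _)).
Qed.

(** Directed elements below the letter 0 are products of the commutators above;
    dividing a directed element by its part below 0 leaves a rooted element below
    1; and rooted elements carry both to every letter. *)
Lemma branch_at_letter x h : branchG h -> branchG (at_letter x h).
Proof.
have sH := branch_subgroup.
have at0_directed b : branchG (at_letter l0 (directed b)).
  apply: (A5_perfect (Q := fun b => branchG (at_letter l0 (directed b)))) => [|b1 b2 h1 h2|].
  - by rewrite directed1 at_letter1; apply: (subgroup1 sH).
  - by rewrite directedM at_letterM; apply: (subgroupM sH).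
  - exact: at_letter0_directed_comm.
have at1_rooted b : branchG (at_letter l1 (rooted b)).
  have -> : at_letter l1 (rooted b) = (at_letter l0 (directed b))^-1 * directed b.
    rewrite (directedE b) belowV belowM; congr below; apply: funext => y.
    rewrite -directedE; have [->|_] := eqVneq y l0; last by rewrite invg1 mul1g.
    by rewrite mulVg ifF // eq_inord.
  exact: (subgroupM sH (subgroupV sH (at0_directed b)) (branch_directed b)).
have move_letter y z g : branchG (at_letter y g) -> branchG (at_letter z g).
  move=> Hyg; have [a <-] := A5_trans y z.
  by rewrite -at_letter_rooted; apply: (subgroupJ sH Hyg (branch_rooted a)).
apply: (branch_ind (P := fun h => branchG (at_letter x h))); last 2 first.
- by move=> a; apply: move_letter (at1_rooted a).
- by move=> b; apply: move_letter (at0_directed b).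
apply: subgroupI => [|g k|g].
- by rewrite at_letter1; apply: (subgroup1 sH).
- by rewrite at_letterM; apply: (subgroupM sH).
- by rewrite at_letterV; apply: (subgroupV sH).
Qed.

(** [below s] is the product of the finitely many [at_letter x (s x)]. *)
Lemma below_in (P : set (sym word)) (s : letter -> sym word) :
  is_subgroup P -> (forall x, P (at_letter x (s x))) -> P (below s).
Proof.
move=> sP Ps.
suff Pr (r : seq letter) : P (below (fun x => if x \in r then s x else 1)).
  have -> : s = (fun x => if x \in enum letter then s x else 1).
    by apply: funext => x; rewrite mem_enum.
  exact: Pr.
elim: r => [|y r IH].
  by rewrite (_ : below _ = 1); [apply: (subgroup1 sP) | apply: below1].
have [yr|yr] := boolP (y \in r).
  rewrite (_ : (fun x => _) = fun x => if x \in r then s x else 1) //.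
  by apply: funext => x; rewrite inE; case: eqP => // ->; rewrite yr.
rewrite (_ : below _ = at_letter y (s y) * below (fun x => if x \in r then s x else 1)).
  exact: (subgroupM sP).
rewrite belowM; congr below; apply: funext => x; rewrite inE.
by case: eqP => [->|_]; rewrite ?(negbTE yr) ?mulg1 ?mul1g.
Qed.

Lemma branch_below s : (forall x, branchG (s x)) -> branchG (below s).
Proof. by move=> Hs; apply: below_in branch_subgroup _ => x; apply: branch_at_letter. Qed.

Lemma branch_decomp h : branchG h ->
  exists a s, (forall x, branchG (s x)) /\ h = rooted a * below s.
Proof.
have sH := branch_subgroup.
apply: (branch_ind (P := fun h =>
  exists a s, (forall x, branchG (s x)) /\ h = rooted a * below s)).
- apply: subgroupI.
  + exists 1, (fun=> 1); rewrite rooted1 below1 mulg1; split=> // _; exact: (subgroup1 sH).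
  + move=> _ _ [a [s [Hs ->]]] [b [t [Ht ->]]].
    exists (a * b), (fun x => s (lact b^-1 x) * t x); split=> [x|]; first exact: (subgroupM sH).
    by rewrite rootedM -belowM -below_conj_rooted conjgE !mulgA mulgK.
  + move=> _ [a [s [Hs ->]]]; exists a^-1, (fun x => (s (lact a x))^-1).
    split=> [x|]; first exact: (subgroupV sH).
    rewrite invgM belowV -rootedV below_rooted; congr (below _ * _).
    by apply: funext => x; rewrite lactKV.
- by move=> a; exists a, (fun=> 1); rewrite below1 mulg1; split=> // _; apply: (subgroup1 sH).
- move=> b; rewrite (directedE b); eexists 1, _; rewrite rooted1 mul1g; split; last by [].
  move=> x /=; case: ifP => _; first exact: branch_directed.
  by case: ifP => _; [apply: branch_rooted | apply: (subgroup1 sH)].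
Qed.

(** The group is generated by two copies of the perfect group [A5]. *)
Lemma branch_perfect (P : set (sym word)) : is_subgroup P ->
  (forall g h, branchG g -> branchG h -> P [~ g, h]) -> forall h, branchG h -> P h.
Proof.
move=> sP PR; apply: branch_ind => // a.
- apply: (A5_perfect (Q := fun a => P (rooted a))) => [|x y|x y].
  + by rewrite rooted1; apply: (subgroup1 sP).
  + by rewrite rootedM; apply: (subgroupM sP).
  + by rewrite rootedR; apply: PR; apply: branch_rooted.
- apply: (A5_perfect (Q := fun a => P (directed a))) => [|x y|x y].
  + by rewrite directed1; apply: (subgroup1 sP).
  + by rewrite directedM; apply: (subgroupM sP).
  + by rewrite directedR; apply: PR; apply: branch_directed.
Qed.

Lemma branch_size h w : branchG h -> size (h w) = size w.
Proof.
move=> Hh; elim: w h Hh => [|x w IH] h /branch_decomp[a [s [Hs ->]]] //=.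
by rewrite IH.
Qed.

Lemma branch_trans (u v : word) : size u = size v -> exists h, branchG h /\ h u = v.
Proof.
elim: u v => [|x u IH] [|y v] //=.
  by exists 1; split=> //; apply: (subgroup1 branch_subgroup).
move=> [/IH[h [Hh <-]]]; have [a <-] := A5_trans x y.
exists (rooted a * at_letter (lact a x) h); split; last by rewrite /= eqxx.
exact: (subgroupM branch_subgroup (branch_rooted a) (branch_at_letter _ Hh)).
Qed.

(** Below the longest common prefix of the two words, it suffices to fix one letter
    and move another. *)
Lemma branch_separates (u v : word) : size u = size v -> u != v ->
  exists h, [/\ branchG h, h u = u & h v != v].
Proof.
elim: u v => [|x u IH] [|y v] //= [suv].
have [<-|xy] := eqVneq x y; last first.
  move=> _; have [a [afix ay]] := A5_separates xy.
  exists (rooted a); rewrite /= afix eqseq_cons (negbTE ay); split=> //; exact: branch_rooted.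
rewrite eqseq_cons eqxx => /(IH _ suv)[h [Hh hu hv]].
exists (at_letter x h); rewrite /= eqxx hu eqseq_cons (negbTE hv) andbF.
by split=> //; apply: branch_at_letter.
Qed.

(** A permutation without fixed letter, applied below all words of length [k]. *)
Lemma branch_mover k : exists g, [/\ branchG g, forall w, size w <= k -> g w = w &
  forall w, k < size w -> g w <> w].
Proof.
elim: k => [|k [g [Hg gfix gmove]]].
  have [c cfree] := A5_free; exists (rooted c); split; first exact: branch_rooted.
    by case.
  by case=> //= x w _ [/eqP]; rewrite (negbTE (cfree x)).
exists (below (fun=> g)); split; first by apply: branch_below.
  by case=> //= x w /gfix ->.
by case=> //= x w /gmove gw [].
Qed.

Lemma branch_take h k w : branchG h -> take k (h w) = h (take k w).
Proof.
elim: w h k => [|x w IH] h [|k] Hh; rewrite ?take0.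
- by apply/esym/size0nil; rewrite branch_size.
- by rewrite (size0nil (branch_size [::] Hh)).
- by apply/esym/size0nil; rewrite branch_size.
by have [a [s [Hs ->]]] := branch_decomp Hh; rewrite /= IH.
Qed.

(** * Normal subgroups of the tree group *)

Definition fixes_level (h : sym word) k := forall w, size w = k -> h w = w.

Lemma branch_nil h : branchG h -> h [::] = [::].
Proof. by move=> Hh; apply/size0nil; rewrite branch_size. Qed.

Notation normal_in_branch := (normal_in branchG).

Lemma at_letter_conj a s x h :
  at_letter x h ^ (rooted a * below s) = at_letter (lact a x) (h ^ s (lact a x)).
Proof.
rewrite conjgM at_letter_rooted /conjg belowV !belowM; congr below.
apply: funext => y; case: eqP => [->//|_].
by rewrite mul1g mulVg.
Qed.

Lemma normal_at_letter_subgroup K x : is_subgroup K ->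
  is_subgroup [set h | K (at_letter x h)]%classic.
Proof.
move=> sK; apply: subgroupI => [|g h|g] /=.
- by rewrite at_letter1; apply: (subgroup1 sK).
- by rewrite at_letterM; apply: (subgroupM sK).
- by rewrite at_letterV; apply: (subgroupV sK).
Qed.

Lemma normal_at_letter K x : normal_in_branch K ->
  normal_in_branch [set h | branchG h /\ K (at_letter x h)]%classic.
Proof.
move=> [sK KH nK]; have sKx := normal_at_letter_subgroup x sK.
split=> [|h []//|g h /= [Hg Kg] Hh].
  apply: subgroupI => [|g h [Hg Kg] [Hh Kh]|g [Hg Kg]].
  - by split; [apply: (subgroup1 branch_subgroup) | apply: (subgroup1 sKx)].
  - by split; [apply: (subgroupM branch_subgroup) | apply: (subgroupM sKx)].
  - by split; [apply: (subgroupV branch_subgroup) | apply: (subgroupV sKx)].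
split; first exact: (subgroupJ branch_subgroup).
rewrite (_ : at_letter x (g ^ h) = at_letter x g ^ at_letter x h); last first.
  by rewrite !conjgE !(at_letterM, at_letterV).
by apply: nK => //; apply: branch_at_letter.
Qed.

Lemma normal_all_letters K x y h : normal_in_branch K ->
  K (at_letter x h) -> K (at_letter y h).
Proof.
move=> [sK KH nK] Kh; have [a <-] := A5_trans x y.
by rewrite -at_letter_rooted; apply: nK => //; apply: branch_rooted.
Qed.

Lemma fixes_level_below h k : branchG h -> fixes_level h k.+1 ->
  exists s, [/\ forall x, branchG (s x), forall x, fixes_level (s x) k & h = below s].
Proof.
move=> Hh hk; have [a [s [Hs eh]]] := branch_decomp Hh.
have a1 : a = 1.
  apply: lact_ext => x; rewrite lact1.
  have := hk (x :: nseq k l0); rewrite /= size_nseq => /(_ erefl).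
  by rewrite eh /= => -[].
exists s; rewrite eh a1 rooted1 mul1g; split=> // x w sw.
have := hk (x :: w); rewrite /= sw => /(_ erefl).
by rewrite eh a1 rooted1 mul1g /= => -[].
Qed.

(** A normal subgroup moving a letter [x] contains, by commutators with elements
    supported below [x], the copy of the (perfect) group below [x]; the rest
    comes from the simplicity of the group permuting the letters. *)
Lemma normal_move_root K g x : normal_in_branch K -> K g -> g [:: x] <> [:: x] ->
  forall h, branchG h -> K h.
Proof.
move=> nK Kg gx; have [sK KH KJ] := nK.
have [a [s [Hs eg]]] := branch_decomp (KH _ Kg).
have amove : lact a x != x by apply/eqP => e; apply: gx; rewrite eg /= e branch_nil.
have Kxx h : branchG h -> K (at_letter x h).
  apply: (branch_perfect (normal_at_letter_subgroup x sK)) => {}h k Hh Hk /=.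
  rewrite (_ : at_letter x [~ h, k] = [~ [~ at_letter x h^-1, g], at_letter x k]).
    apply: (normal_in_comm nK) (branch_at_letter _ Hk).
    rewrite -invgR; apply: (subgroupV sK); apply: (normal_in_comm nK) => //.
    by apply: branch_at_letter; apply: (subgroupV branch_subgroup).
  rewrite (commgEl _ g) eg at_letter_conj -at_letterV invgK belowM belowR.
  congr below; apply: funext => y; have [->|yx] := eqVneq y x; last by rewrite commg1.
  by rewrite eq_sym (negbTE amove) mulg1.
have Kat y h : branchG h -> K (at_letter y h) by move=> /Kxx; apply: normal_all_letters.
have Kbelow t : (forall y, branchG (t y)) -> K (below t).
  by move=> Ht; apply: below_in => // y; apply: Kat.
have Krooted : forall b, K (rooted b).
  apply: (@A5_normal_full (fun b => K (rooted b)) a) => [|b c|b c Kb||].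
  - by rewrite rooted1; apply: (subgroup1 sK).
  - by rewrite rootedM; apply: (subgroupM sK).
  - by rewrite conjgE !(rootedM, rootedV); apply: KJ => //; apply: branch_rooted.
  - rewrite -[rooted a](mulgK (below s)) -eg.
    exact: (subgroupM sK Kg (subgroupV sK (Kbelow s Hs))).
  - by apply: contra amove => /eqP->; rewrite lact1.
by move=> h /branch_decomp[b [t [Ht ->]]]; apply: (subgroupM sK) => //; apply: Kbelow.
Qed.

(** Hence the nontrivial normal subgroups are exactly the stabilizers of the
    levels. In the induction, the elements of [K] supported below a letter [x] form
    a normal subgroup of the copy of the group below [x]; it is not trivial, for if
    [g] moves [w] below [x], then its commutator with an element below [x] that fixes
    [w] and moves the image of [w] is not trivial. *)
Lemma normal_level_stabilizer k K g w : normal_in_branch K ->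
  (forall f, K f -> fixes_level f k) -> K g -> size w = k.+1 -> g w <> w ->
  forall h, branchG h -> fixes_level h k -> K h.
Proof.
elim: k K g w => [|k IH] K g w nK Kk Kg sw gw h Hh hk.
  case: w sw gw => [|x []] //= _ gx; exact: normal_move_root gx _ Hh.
have [sK KH KJ] := nK.
have [s [Hs _ eg]] := fixes_level_below (KH _ Kg) (Kk _ Kg).
case: w sw gw => [|x w] //= [sw] gw.
have sxw : s x w != w by apply/eqP => e; apply: gw; rewrite eg /= e.
have Kx f : branchG f -> fixes_level f k -> K (at_letter x f).
  move=> Hf fk.
  have ws : w != s x w by rewrite eq_sym.
  have [p [Hp pw pm]] := branch_separates (esym (branch_size w (Hs x))) ws.
  suff [] : [set h | branchG h /\ K (at_letter x h)]%classic f by [].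
  apply: (IH _ [~ s x, p] (s x w)) => //.
  - exact: normal_at_letter.
  - move=> q [Hq Kq] v sv; have := Kk _ Kq (x :: v).
    by rewrite /= eqxx sv => /(_ erefl)[].
  - split; first exact: (subgroupR branch_subgroup (Hs x) Hp).
    rewrite (_ : at_letter _ _ = [~ g, at_letter x p]).
      by apply: (normal_in_comm nK) => //; apply: branch_at_letter.
    rewrite eg belowR; congr below; apply: funext => y.
    by case: eqP => [->//|]; rewrite commg1.
  - by rewrite branch_size.
  - rewrite /commg /conjg !symM symK (symV pw); exact/eqP.
have [t [Ht tk ->]] := fixes_level_below Hh hk.
by apply: below_in => // y; apply: (@normal_all_letters _ x) => //; apply: Kx.
Qed.

(** * Decorating the levels of the tree *)

(** Elements of a permutational wreath product over pairs of words: [s] sends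
    [(u, v, a)] to [(dperm s u, v, a * dlab s u v)]. The second word [v] indexes a
    layer; the permutation moves words inside each layer and preserves the layers,
    so that permuting layers commutes with the multiplication. *)
Record deco := Deco { dperm : sym word; dlab : word -> word -> A5 }.

Lemma deco_ext s t : dperm s = dperm t -> (forall u v, dlab s u v = dlab t u v) -> s = t.
Proof.
case: s t => h f [h' f'] /= -> e; congr Deco.
by apply: funext => u; apply: funext => v; apply: e.
Qed.

HB.instance Definition _ := gen_eqMixin deco.
HB.instance Definition _ := gen_choiceMixin deco.

Definition deco_one := Deco 1 (fun _ _ => 1).
Definition deco_mul s t :=
  Deco (dperm s * dperm t) (fun u v => dlab s u v * dlab t (dperm s u) v).
Definition deco_inv s :=
  Deco (dperm s)^-1 (fun u v => (dlab s ((dperm s)^-1 u) v)^-1).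

Fact deco_mulA : associative deco_mul.
Proof.
by move=> r s t; apply: deco_ext => [|u v] /=; rewrite mulgA.
Qed.
Fact deco_mul1 : left_id deco_one deco_mul.
Proof. by move=> s; apply: deco_ext => [|u v] /=; rewrite mul1g. Qed.
Fact deco_1mul : right_id deco_one deco_mul.
Proof. by move=> s; apply: deco_ext => [|u v] /=; rewrite mulg1. Qed.
Fact deco_mulV : left_inverse deco_one deco_inv deco_mul.
Proof. by move=> s; apply: deco_ext => [|u v] /=; rewrite mulVg. Qed.
Fact deco_Vmul : right_inverse deco_one deco_inv deco_mul.
Proof.
by move=> s; apply: deco_ext => [|u v] /=; rewrite ?sfunK mulgV.
Qed.

HB.instance Definition _ := isGroup.Build deco
  deco_mulA deco_mul1 deco_1mul deco_mulV deco_Vmul.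

Lemma dpermM s t : dperm (s * t) = dperm s * dperm t. Proof. by []. Qed.
Lemma dlabM s t u v : dlab (s * t) u v = dlab s u v * dlab t (dperm s u) v.
Proof. by []. Qed.
Lemma dpermV s : dperm s^-1 = (dperm s)^-1. Proof. by []. Qed.
Lemma dlabV s u v : dlab s^-1 u v = (dlab s ((dperm s)^-1 u) v)^-1.
Proof. by []. Qed.

Definition pure (h : sym word) := Deco h (fun _ _ => 1).
Definition lab (f : word -> word -> A5) := Deco 1 f.

Lemma pureM g h : pure (g * h) = pure g * pure h.
Proof. by apply: deco_ext => // u v /=; rewrite mulg1. Qed.
Lemma pureV g : pure g^-1 = (pure g)^-1.
Proof. by apply: deco_ext => // u v /=; rewrite invg1. Qed.
Lemma labM f g : lab f * lab g = lab (fun u v => f u v * g u v).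
Proof. by apply: deco_ext => //=; rewrite mulg1. Qed.
Lemma labV f : (lab f)^-1 = lab (fun u v => (f u v)^-1).
Proof. by apply: deco_ext => //=; rewrite invg1. Qed.
Lemma lab1 : lab (fun _ _ => 1) = 1. Proof. by []. Qed.
Lemma labR f g : [~ lab f, lab g] = lab (fun u v => [~ f u v, g u v]).
Proof. by rewrite /commg /conjg !(labV, labM). Qed.
Lemma lab_conj_pure f h : lab f ^ pure h = lab (fun u v => f (h^-1 u) v).
Proof.
rewrite /conjg; apply: deco_ext => [|u v] /=.
  by rewrite mul1g mulVg.
by rewrite invg1 mul1g mulg1.
Qed.
Definition diag (P : pred word) (e : A5) : deco :=
  lab (fun u v => if (u == v) && P v then e else 1).
Definition spot (x y : word) (e : A5) : deco :=
  lab (fun u v => if (u == x) && (v == y) then e else 1).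

(** The label of [diag predT e] in the layer of [v] sits at the word [v]. This mark
    differs from layer to layer, which lets commutators tell the layers apart, and
    yet a single generator [diag predT e] serves all layers at once. *)
Definition decoG : set deco := smallest (@is_subgroup _)
  (range (pure \o rooted) `|` range (pure \o directed) `|` range (diag predT))%classic.

Lemma decoG_subgroup : is_subgroup decoG.
Proof. exact: generated_subgroup. Qed.

Lemma decoG_ind (P : set deco) : is_subgroup P ->
  (forall a, P (pure (rooted a))) -> (forall b, P (pure (directed b))) ->
  (forall e, P (diag predT e)) -> forall s, decoG s -> P s.
Proof.
move=> sP PA PB PE s; apply: smallest_sub s => //.
by move=> _ [[[a _ <-]|[b _ <-]]|[e _ <-]] /=.
Qed.

Lemma decoG_pure h : branchG h -> decoG (pure h).
Proof.
apply: (@branch_ind (fun h => decoG (pure h))).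
- apply: subgroupI => [|g k|g].
  + exact: (subgroup1 decoG_subgroup).
  + by rewrite pureM; apply: (subgroupM decoG_subgroup).
  + by rewrite pureV; apply: (subgroupV decoG_subgroup).
- by move=> a; apply: sub_gen_smallest; left; left; exists a.
- by move=> b; apply: sub_gen_smallest; left; right; exists b.
Qed.

Lemma decoG_diagT e : decoG (diag predT e).
Proof. by apply: sub_gen_smallest; right; exists e. Qed.

Lemma decoG_perm s : decoG s -> branchG (dperm s).
Proof.
apply: (@decoG_ind (fun s => branchG (dperm s))).
- apply: subgroupI => [|g k|g].
  + exact: (subgroup1 branch_subgroup).
  + exact: (subgroupM branch_subgroup).
  + exact: (subgroupV branch_subgroup).
- exact: branch_rooted.
- exact: branch_directed.
- by move=> e; apply: (subgroup1 branch_subgroup).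
Qed.

Lemma decoG_lab s u v : decoG s -> size u <> size v -> dlab s u v = 1.
Proof.
move=> Gs uv; have Hs := decoG_perm Gs.
suff [] : branchG (dperm s) /\ forall u, size u <> size v -> dlab s u v = 1 by move=> _; apply.
apply: (@decoG_ind (fun s => branchG (dperm s) /\ forall u, size u <> size v -> dlab s u v = 1)
  _ _ _ _ _ Gs) => {s Gs Hs u uv} [|a|b|e].
- apply: subgroupI => [|s t [Hs s1] [Ht t1]|s [Hs s1]].
  + by split=> //; apply: (subgroup1 branch_subgroup).
  + split=> [|u uv]; first exact: (subgroupM branch_subgroup).
    by rewrite dlabM s1 // t1 ?mulg1 // branch_size.
  + have Hs' := subgroupV branch_subgroup Hs; split=> // u uv.
    by rewrite dlabV s1 ?invg1 // branch_size.
- by split=> //; apply: branch_rooted.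
- by split=> //; apply: branch_directed.
- split=> [|u uv /=]; first exact: (subgroup1 branch_subgroup).
  by case: eqP => // e'; rewrite e' in uv.
Qed.

(** Sets of layers that can be labelled independently of the other layers. They
    form a Boolean algebra: intersections come from commutators, as the labels form
    a perfect group. *)
Definition isolated (P : pred word) := forall e, decoG (diag P e).

Lemma diagM P d e : diag P (d * e) = diag P d * diag P e.
Proof.
rewrite /diag labM; congr lab; apply: funext => u; apply: funext => v.
by case: ifP; rewrite ?mulg1.
Qed.

Lemma diag1 P : diag P 1 = 1.
Proof.
by rewrite -lab1; congr lab; apply: funext => u; apply: funext => v; case: ifP.
Qed.

Lemma isolated_comm P : (forall d e, decoG (diag P [~ d, e])) -> isolated P.
Proof.
move=> PR; apply: (@A5_perfect (fun e => decoG (diag P e))) => // [|d e].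
  by rewrite diag1; apply: (subgroup1 decoG_subgroup).
by rewrite diagM; apply: (subgroupM decoG_subgroup).
Qed.

(** Conjugation by [h] takes the mark of the layer of [v] away from [v] unless [h]
    fixes [v]; only in the latter case can the commutator be nontrivial there. *)
Lemma isolated_fix P h : isolated P -> branchG h -> isolated (fun w => (h w == w) && P w).
Proof.
move=> iP Hh; apply: isolated_comm => d e.
rewrite (_ : diag _ _ = [~ diag P d ^ pure h, diag P e]).
  have sG := decoG_subgroup.
  exact: (subgroupR sG (subgroupJ sG (iP d) (decoG_pure Hh)) (iP e)).
rewrite lab_conj_pure labR; congr lab; apply: funext => u; apply: funext => v.
have [->|uv] := eqVneq u v; last by rewrite commg1.
rewrite (_ : (h^-1 v == v) = (h v == v)); last first.
  by apply/eqP/eqP => e'; [rewrite -{1}e' symVK | exact: symV].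
by case: (h v == v); case: (P v); rewrite ?comm1g ?commg1.
Qed.

Lemma isolatedI P Q : isolated P -> isolated Q -> isolated (fun w => P w && Q w).
Proof.
move=> iP iQ; apply: isolated_comm => d e.
rewrite (_ : diag _ _ = [~ diag P d, diag Q e]); first exact: (subgroupR decoG_subgroup).
rewrite labR; congr lab; apply: funext => u; apply: funext => v.
by case: (u == v); case: (P v); case: (Q v); rewrite ?comm1g ?commg1.
Qed.

Lemma isolatedC P : isolated P -> isolated (fun w => ~~ P w).
Proof.
move=> iP e.
rewrite (_ : diag _ _ = diag predT e * (diag P e)^-1).
  exact: (subgroupM decoG_subgroup (decoG_diagT e) (subgroupV decoG_subgroup (iP e))).
rewrite labV labM; congr lab; apply: funext => u; apply: funext => v.
by case: (u == v); case: (P v); rewrite ?mulgV ?invg1 ?mulg1.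
Qed.

Lemma isolated_ext P Q : P =1 Q -> isolated P -> isolated Q.
Proof. by move=> PQ; rewrite (funext PQ). Qed.

Lemma isolated_size k : isolated (fun w => size w <= k).
Proof.
have [g [Hg gfix gmove]] := branch_mover k.
apply: isolated_ext (isolated_fix decoG_diagT Hg) => w /=; rewrite andbT.
by case: leqP => [/gfix ->|/gmove/eqP/negbTE->]; rewrite ?eqxx.
Qed.

Lemma isolated_separate u v : u != v -> exists P, [/\ isolated P, P v & ~~ P u].
Proof.
move=> uv; have [suv|suv|suv] := ltngtP (size u) (size v).
- exists (fun w => ~~ (size w <= size u)); rewrite -ltnNge suv leqnn.
  by split=> //; exact (isolatedC (@isolated_size (size u))).
- exists (fun w => size w <= size v); rewrite leqnn -ltnNge suv.
  by split=> //; exact (@isolated_size (size v)).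
- rewrite eq_sym in uv; have [h [Hh hv hu]] := branch_separates (esym suv) uv.
  exists (fun w => h w == w); rewrite hv eqxx; split=> //.
  by apply: isolated_ext (isolated_fix decoG_diagT Hh) => w /=; rewrite andbT.
Qed.

Fixpoint words_upto n : seq word :=
  if n is n'.+1 then [::] :: [seq x :: w | x <- enum letter, w <- words_upto n']
  else [:: [::]].

Lemma mem_words_upto n w : size w <= n -> w \in words_upto n.
Proof.
elim: n w => [|n IH] [|x w] sw //; rewrite /= ?mem_head //.
by rewrite inE allpairs_f ?orbT ?mem_enum ?IH.
Qed.

(** Isolated sets separate any two words and contain the set of all words of
    bounded length, so finitely many of them cut out a single word. *)
Lemma isolated1 v : isolated (pred1 v).
Proof.
suff [P [iP Pv Pr]] : exists P, [/\ isolated P, P v &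
    forall u, u \in words_upto (size v) -> u != v -> ~~ P u].
  apply: isolated_ext (isolatedI iP (isolated_size (size v))) => w /=.
  have [->|wv] := eqVneq w v; first by rewrite Pv leqnn.
  by case: leqP; rewrite ?andbF // => /mem_words_upto/Pr/(_ wv)/negbTE->.
elim: words_upto => [|u r [P [iP Pv Pr]]].
  by exists predT; split=> //; apply: decoG_diagT.
have [e|uv] := eqVneq u v.
  by exists P; split=> // w; rewrite inE e => /predU1P[->|/Pr//]; rewrite eqxx.
have [Q [iQ Qv Qu]] := isolated_separate uv.
exists (fun w => P w && Q w); rewrite Pv Qv; split=> //; first exact: isolatedI.
move=> w; rewrite inE => /predU1P[-> _|/Pr Pw /Pw/negbTE->] //.
by rewrite (negbTE Qu) andbF.
Qed.

Lemma decoG_spot u v e : size u = size v -> decoG (spot u v e).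
Proof.
move=> /esym/branch_trans[h [/decoG_pure Gh <-]].
rewrite (_ : spot _ _ _ = diag (pred1 v) e ^ pure h).
  exact: (subgroupJ decoG_subgroup (isolated1 v e) Gh).
rewrite lab_conj_pure; congr lab; apply: funext => x; apply: funext => y /=.
have [->|yv] := eqVneq y v; last by rewrite !andbF.
by rewrite !andbT -[x in LHS](symVK h) (inj_eq (@sym_inj _ h)).
Qed.

Lemma spotM u v d e : spot u v (d * e) = spot u v d * spot u v e.
Proof.
rewrite labM; congr lab; apply: funext => x; apply: funext => y.
by case: ifP; rewrite ?mulg1.
Qed.

Lemma spot1 u v : spot u v 1 = 1.
Proof.
by rewrite -lab1; congr lab; apply: funext => x; apply: funext => y; case: ifP.
Qed.

Lemma spot_conj_pure u v e h : spot u v e ^ pure h = spot (h u) v e.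
Proof.
rewrite lab_conj_pure; congr lab; apply: funext => x; apply: funext => y.
by rewrite -[in RHS](symVK h x) (inj_eq (@sym_inj _ h)).
Qed.

(** An element with finitely many nontrivial labels is a product of spots. *)
Lemma lab_finite (P : set deco) k f : is_subgroup P ->
  (forall u v, size u = size v -> size v <= k -> P (spot u v (f u v))) ->
  (forall u v, f u v != 1 -> size u = size v /\ size v <= k) -> P (lab f).
Proof.
move=> sP Ps fk.
pose r := [seq (u, v) | u <- words_upto k, v <- words_upto k].
have fr u v : f u v != 1 -> (u, v) \in r.
  by move=> /fk[uv vk]; apply: allpairs_f; apply: mem_words_upto; rewrite ?uv.
suff Pr (r' : seq (word * word)) : P (lab (fun u v => if (u, v) \in r' then f u v else 1)).
  rewrite (_ : f = fun u v => if (u, v) \in r then f u v else 1) //.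
  apply: funext => u; apply: funext => v; case: ifP => // /negbT uv.
  by apply/eqP; apply: contraNT uv => /fr.
have Pspot u v : P (spot u v (f u v)).
  have [->|/fk[]] := eqVneq (f u v) 1; last exact: Ps.
  by rewrite spot1; apply: (subgroup1 sP).
elim: r' => [|[x y] r' IH]; first exact: (subgroup1 sP).
have [xr|xr] := boolP ((x, y) \in r').
  rewrite (_ : (fun u v => _) = fun u v => if (u, v) \in r' then f u v else 1) //.
  apply: funext => u; apply: funext => v; rewrite inE.
  by case: eqP => // -[-> ->]; rewrite xr.
rewrite (_ : lab _ = spot x y (f x y) * lab (fun u v => if (u, v) \in r' then f u v else 1)).
  exact: (subgroupM sP).
rewrite labM; congr lab; apply: funext => u; apply: funext => v.
rewrite inE xpair_eqE; have [->|_] := eqVneq u x; last by rewrite mul1g.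
by have [->|_] := eqVneq v y; rewrite ?(negbTE xr) ?mulg1 ?mul1g.
Qed.

Lemma decoG_lab_finite k f :
  (forall u v, f u v != 1 -> size u = size v /\ size v <= k) -> decoG (lab f).
Proof.
by apply: lab_finite decoG_subgroup _ => u v uv _; apply: decoG_spot.
Qed.

(** * Normal subgroups of the decorated group *)

Lemma lab_conj f s :
  lab f ^ s = lab (fun u v => f ((dperm s)^-1 u) v ^ dlab s ((dperm s)^-1 u) v).
Proof.
rewrite /conjg; apply: deco_ext => [|u v] /=; last by [].
by rewrite mul1g mulVg.
Qed.

Definition full (N : set deco) (v : word) :=
  forall u e, size u = size v -> N (spot u v e).

(** A bound for the index of [N] in [decoG], as a bound for the number of elements
    that are pairwise incongruent modulo [N]. *)
Definition index_le (N : set deco) (n : nat) :=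
  forall (X : finType) (phi : X -> deco), (forall x, decoG (phi x)) ->
    (forall x y, N ((phi x)^-1 * phi y) -> x = y) -> #|X| <= n.

Section NormalSubgroup.
Variables (N : set deco) (nN : normal_in decoG N).

Let sN : is_subgroup N. Proof. by case: nN. Qed.
Let NG s : N s -> decoG s. Proof. by case: nN => _ NG _; apply: NG. Qed.
Let NJ s t : N s -> decoG t -> N (s ^ t). Proof. by case: nN => _ _; apply. Qed.

Lemma spot_full u v e : size u = size v -> e != 1 -> N (spot u v e) -> full N v.
Proof.
move=> uv e1 Ne w d wv.
have [h [Hh <-]] := branch_trans (etrans uv (esym wv)).
rewrite -spot_conj_pure; apply: NJ (decoG_pure Hh).
apply: (@A5_normal_full (fun d => N (spot u v d)) e) => // [|x y|x y Nx].
- by rewrite spot1; apply: (subgroup1 sN).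
- by rewrite spotM; apply: (subgroupM sN).
- rewrite (_ : spot u v (x ^ y) = spot u v x ^ spot u v y).
    by apply: NJ => //; apply: decoG_spot.
  rewrite /conjg labV !labM; congr lab; apply: funext => a; apply: funext => b.
  by case: ifP => //; rewrite invg1 !mulg1.
Qed.

Lemma labR_spot f u v e : [~ lab f, spot u v e] = spot u v [~ f u v, e].
Proof.
rewrite labR; congr lab; apply: funext => x; apply: funext => y.
by case: ifP => [/andP[/eqP-> /eqP->]//|_]; rewrite commg1.
Qed.

(** A normal subgroup with a nontrivial element in a layer contains, by a
    commutator, a nontrivial spot, and then the whole layer since [A5] is simple
    and [branchG] is transitive on the words of the layer. *)
Lemma layer_trivial v f : ~ full N v -> N (lab f) ->
  (forall u w, w != v -> f u w = 1) -> lab f = 1.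
Proof.
move=> vN Nf fv; rewrite -lab1; congr lab; apply: funext => u; apply: funext => w.
have [->|/fv //] := eqVneq w v.
have [uv|/eqP uv] := eqVneq (size u) (size v); last exact: (decoG_lab (NG Nf)).
apply/eqP/negPn/negP => /A5_centerless[e fe]; apply: vN.
apply: (spot_full uv fe); rewrite -labR_spot.
by apply: (normal_in_comm nN) => //; apply: decoG_spot.
Qed.

(** The commutator lies in [N] and in the layer of [v], which meet trivially. *)
Lemma normal_commute_spot s u v e : ~ full N v -> N s -> size u = size v ->
  commute s (spot u v e).
Proof.
move=> vN Ns uv; apply/commgP/eqP.
have eR : [~ s, spot u v e] = lab (dlab [~ s, spot u v e]).
  by rewrite commgEr labV lab_conj labM.
rewrite eR; apply: (layer_trivial vN) => [|x w wv].
  by rewrite -eR; apply: (normal_in_comm nN) => //; apply: decoG_spot.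
rewrite commgEr labV lab_conj labM /= (negbTE wv) !andbF.
by rewrite invg1 mulg1 conj1g.
Qed.

Definition nonfull_labels : set deco :=
  [set b | [/\ decoG b, dperm b = 1 & forall u v, full N v -> dlab b u v = 1]]%classic.

Lemma nonfull_labels_normal : normal_in decoG nonfull_labels.
Proof.
have sG := decoG_subgroup.
split=> [|s []//|s t [Gs s1 sN'] Gt].
- apply: subgroupI => [|s t [Gs s1 sN'] [Gt t1 tN]|s [Gs s1 sN']].
  + by split=> //; apply: (subgroup1 sG).
  + split=> [||u v vN]; first exact: (subgroupM sG).
      by rewrite dpermM s1 t1 mulg1.
    by rewrite dlabM sN' // tN // mulg1.
  + split=> [||u v vN]; first exact: (subgroupV sG).
      by rewrite dpermV s1 invg1.
    by rewrite dlabV sN' // invg1.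
- have es : s = lab (dlab s) by apply: deco_ext.
  split=> [||u v vN]; first exact: (subgroupJ sG).
    by rewrite es lab_conj.
  by rewrite es lab_conj /= sN' // conj1g.
Qed.

Definition with_nonfull : set deco :=
  [set s | exists a b, [/\ N a, nonfull_labels b & s = a * b]]%classic.

Lemma with_nonfull_normal : normal_in decoG with_nonfull.
Proof. exact: (normal_in_mul decoG_subgroup nN nonfull_labels_normal). Qed.

Lemma with_nonfullN s : N s -> with_nonfull s.
Proof.
move=> Ns; exists s, 1; rewrite mulg1; split=> //.
by have [sS _ _] := nonfull_labels_normal; apply: (subgroup1 sS).
Qed.

Lemma with_nonfull_spot u v e : size u = size v -> with_nonfull (spot u v e).
Proof.
move=> uv; have [vN|vN] := pselect (full N v).
  by apply: with_nonfullN; apply: vN.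
exists 1, (spot u v e); rewrite mul1g; split=> //; first exact: (subgroup1 sN).
split=> // [|x w wN]; first exact: decoG_spot.
by rewrite /= ifF //; apply/negP => /andP[_ /eqP wv]; apply: vN; rewrite -wv.
Qed.

Lemma with_nonfull_finite k f :
  (forall u v, f u v != 1 -> size u = size v /\ size v <= k) -> with_nonfull (lab f).
Proof.
have [sM _ _] := with_nonfull_normal.
by apply: (lab_finite sM) => u v uv _; apply: with_nonfull_spot.
Qed.

Variables (n : nat) (finN : index_le N n).

(** Let [g k] fix the words of length at most [k] and move the longer ones. Among
    [g 0], .., [g n] two are congruent modulo [N]; for [x < y] the quotient of [g x]
    and [g y] moves all words of length [y], hence all longer words. *)
Lemma normal_mover : exists h k,
  [/\ branchG h, N (pure h) & forall w, k < size w -> h w <> w].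
Proof.
pose g k := projT1 (cid (branch_mover k)).
have gP k : [/\ branchG (g k), forall w, size w <= k -> g k w = w &
    forall w, k < size w -> g k w <> w] := projT2 (cid (branch_mover k)).
have Hg k : branchG (g k) by case: (gP k).
apply: contrapT => noh.
suff : forall x y : 'I_n.+1, N ((pure (g x))^-1 * pure (g y)) -> x = y.
  by move=> inj; have := @finN 'I_n.+1 _ (fun x => decoG_pure (Hg x)) inj; rewrite card_ord ltnn.
suff gN (x y : 'I_n.+1) : x < y -> ~ N ((pure (g x))^-1 * pure (g y)).
  move=> x y Nxy; apply: val_inj => /=.
  have [/gN //|/gN yx|//] := ltngtP x y; exfalso; apply: yx.
  by rewrite -[_ * _]invgK invgM invgK; apply: (subgroupV sN).
move=> xy; rewrite -pureV -pureM => Nxy; apply: noh.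
exists ((g x)^-1 * g y), y; split=> //.
  exact: (subgroupM branch_subgroup (subgroupV branch_subgroup (Hg x)) (Hg y)).
move=> w yw /(congr1 (take y)); rewrite symM.
have Hx := subgroupV branch_subgroup (Hg x).
have syw : size (take y w) = y by rewrite size_take yw.
have [_ gy _] := gP y.
rewrite !branch_take // gy; last by rewrite (branch_size _ Hx) syw.
have [_ _ gx] := gP x; move=> e; apply: (gx (take y w)); first by rewrite syw.
by rewrite -{1}e symVK.
Qed.

(** Modulo finitely many spots, the double commutator of an element moving all
    long words with two diagonal elements is the diagonal element of their
    commutator. *)
Lemma with_nonfull_diag e : with_nonfull (diag predT e).
Proof.
have [sM MG nM] := with_nonfull_normal.
apply: (@A5_perfect (fun e => with_nonfull (diag predT e))) => {e} [|d e|d e].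
- by rewrite diag1; apply: (subgroup1 sM).
- by rewrite diagM; apply: (subgroupM sM).
have [h [k [Hh Nh hk]]] := normal_mover.
pose t := [~ [~ pure h, diag predT d], diag predT e].
have Nt : N t.
  exact: (normal_in_comm nN (normal_in_comm nN Nh (decoG_diagT d)) (decoG_diagT e)).
rewrite -(mulVKg t (diag _ _)); apply: (subgroupM sM); first exact: with_nonfullN.
rewrite /t (commgEr (pure h)) labV lab_conj_pure labM labR labV labM.
apply: (with_nonfull_finite (k := k)) => u v.
rewrite !andbT; have [->|uv] := eqVneq u v; last by rewrite commg1 invg1 mulg1 eqxx.
case: (leqP (size v) k) => // kv.
rewrite ifF; last by apply/eqP => e1; have := symV e1; rewrite invgK; apply: hk.
by rewrite invg1 mul1g mulVg eqxx.
Qed.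

Lemma with_nonfull_perm s : decoG s -> with_nonfull (s * (pure (dperm s))^-1).
Proof.
have [sM MG nM] := with_nonfull_normal; have sG := decoG_subgroup => Gs.
suff [] : decoG s /\ with_nonfull (s * (pure (dperm s))^-1) by [].
have Gpure t : decoG t -> decoG (pure (dperm t)) by move=> /decoG_perm/decoG_pure.
apply: (@decoG_ind (fun s => decoG s /\ with_nonfull (s * (pure (dperm s))^-1)) _ _ _ _ _ Gs).
- apply: subgroupI => [|x y [Gx Mx] [Gy My]|x [Gx Mx]].
  + by split; [apply: (subgroup1 sG) | rewrite mulgV; apply: (subgroup1 sM)].
  + split; first exact: (subgroupM sG).
    have -> : x * y * (pure (dperm (x * y)))^-1 =
        (y * (pure (dperm y))^-1) ^ x^-1 * (x * (pure (dperm x))^-1).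
      by rewrite dpermM pureM invgM conjgE invgK !mulgA mulgVK.
    by apply: (subgroupM sM) => //; apply: nM => //; apply: (subgroupV sG).
  + split; first exact: (subgroupV sG).
    have -> : x^-1 * (pure (dperm x^-1))^-1 =
        ((x * (pure (dperm x))^-1) ^ pure (dperm x))^-1.
      by rewrite conjgE mulgVK invgM invgK dpermV pureV invgK.
    by apply: (subgroupV sM); apply: nM => //; apply: Gpure.
- move=> a; rewrite mulgV; split; last exact: (subgroup1 sM).
  exact: decoG_pure (branch_rooted a).
- move=> a; rewrite mulgV; split; last exact: (subgroup1 sM).
  exact: decoG_pure (branch_directed a).
- move=> e; split; first exact: decoG_diagT.
  rewrite (_ : (pure _)^-1 = 1) ?mulg1; first exact: with_nonfull_diag.
  by rewrite -pureV invg1.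
Qed.

(** All labels lie in the product of [N] and the labels outside the full layers:
    the generators [diag predT e] do, and this product is a normal subgroup. *)
Lemma with_nonfull_lab s : decoG s -> dperm s = 1 -> with_nonfull s.
Proof.
by move=> /with_nonfull_perm + s1; rewrite s1 (_ : pure 1 = 1) // invg1 mulg1.
Qed.

Definition perm_image : set (sym word) :=
  [set h | exists s, N s /\ dperm s = h]%classic.

Lemma perm_image_normal : normal_in_branch perm_image.
Proof.
split=> [|_ [s [Ns <-]]|_ h [s [Ns <-]] Hh].
- apply: subgroupI => [|_ _ [s [Ns <-]] [t [Nt <-]]|_ [s [Ns <-]]].
  + by exists 1; split=> //; apply: (subgroup1 sN).
  + by exists (s * t); split=> //; apply: (subgroupM sN).
  + by exists s^-1; split=> //; apply: (subgroupV sN).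
- exact: decoG_perm (NG Ns).
- by exists (s ^ pure h); split; [apply: NJ Ns (decoG_pure Hh) | rewrite conjgE !dpermM dpermV].
Qed.

(** The level is the last one before the first level on which [N] acts
    nontrivially. *)
Lemma perm_image_level : exists k, forall h, perm_image h <-> branchG h /\ fixes_level h k.
Proof.
have [sK KH nK] := perm_image_normal.
pose moved k := `[< exists g w, [/\ perm_image g, size w = k & g w <> w] >].
have [h [k0 [Hh Nh hk]]] := normal_mover.
have ex : exists k, moved k.
  exists k0.+1; apply/asboolP; exists h, (nseq k0.+1 l0).
  by rewrite size_nseq; split=> //; [exists (pure h) | apply: hk; rewrite size_nseq].
case: (ex_minnP ex) => -[|k] /asboolP[g [w [Kg sw gw]]] kmin.
  by case: gw; rewrite (size0nil sw) branch_nil //; apply: KH.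
have Kk f : perm_image f -> fixes_level f k.
  move=> Kf v sv; apply: contrapT => fv.
  have : moved k by apply/asboolP; exists f, v.
  by move=> /kmin; rewrite ltnn.
exists k => f; split=> [Kf|[Hf fk]]; first by split; [apply: KH | apply: Kk].
exact: (normal_level_stabilizer perm_image_normal Kk Kg sw gw Hf fk).
Qed.

(** Elements taking one word of level [k] to different words are incongruent. *)
Lemma perm_image_level_index k :
  (forall h, perm_image h <-> branchG h /\ fixes_level h k) -> 5 ^ k <= n.
Proof.
move=> Kk.
have ex (t : k.-tuple letter) : exists h, branchG h /\ h (nseq k l0) = t.
  by apply: branch_trans; rewrite size_nseq size_tuple.
pose h t := projT1 (cid (ex t)).
have hP t : branchG (h t) /\ h t (nseq k l0) = t := projT2 (cid (ex t)).
have := @finN (k.-tuple letter) (fun t => pure (h t)).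
rewrite card_tuple card_ord; apply=> [t|t t' Ntt'].
  by apply: decoG_pure; case: (hP t).
have [_ /(_ t)] : branchG ((h t)^-1 * h t') /\ fixes_level ((h t)^-1 * h t') k.
  by apply/Kk; exists ((pure (h t))^-1 * pure (h t')).
rewrite size_tuple symM (symV (hP t).2) (hP t').2 => /(_ erefl) e.
exact/val_inj/esym.
Qed.

(** The labellings of a layer that is not full by the trivial and one nontrivial
    label are pairwise incongruent modulo [N]. *)
Lemma layer_index v : ~ full N v -> 2 ^ (5 ^ size v) <= n.
Proof.
move=> vN; have [a [b ab]] := A5_noncommuting; set e := [~ a, b] in ab.
pose k := size v.
pose ext (phi : {ffun k.-tuple letter -> bool}) u w :=
  if (w == v) && (size u == k) then
    if phi (insubd (nseq_tuple k l0) u) then e else 1 else 1.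
have := @finN {ffun k.-tuple letter -> bool} (fun phi => lab (ext phi)).
rewrite card_ffun card_bool card_tuple card_ord; apply=> [phi|phi psi].
  apply: (@decoG_lab_finite k) => u w; rewrite /ext.
  by case: andP => [[/eqP-> /eqP->]|]; rewrite ?eqxx.
rewrite labV labM => Nphi; apply/ffunP => t.
have tr u w : w != v -> (ext phi u w)^-1 * ext psi u w = 1.
  by rewrite /ext => /negbTE->; rewrite mulVg.
have := congr1 (fun s => dlab s t v) (layer_trivial vN Nphi tr).
rewrite /= /ext eqxx size_tuple eqxx /= valKd.
by case: (phi t); case: (psi t) => // /eqP; rewrite ?invg1 ?mulg1 ?mul1g ?invg_eq1 (negbTE ab).
Qed.

End NormalSubgroup.

(** A normal subgroup of finite index is the centralizer of the layers that are
    not full, inside the preimage of its image in [branchG]: an element of the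
    preimage differs from an element of the subgroup by labels in those layers, and
    such labels centralize the layers only if they are trivial. *)
Lemma normal_determined N M n m : normal_in decoG N -> normal_in decoG M ->
  index_le N n -> index_le M m ->
  (forall v, full N v <-> full M v) -> (perm_image N `<=` perm_image M)%classic ->
  (N `<=` M)%classic.
Proof.
move=> nN nM fN fM fNM pNM s Ns.
have [sM MG _] := nM; have [_ NG _] := nN.
have [|t [Mt ts]] := pNM (dperm s); first by exists s.
have [|| a [b [Ma [Gb b1 bM] eb]]] := @with_nonfull_lab M nM _ fM (t^-1 * s).
- exact: (subgroupM decoG_subgroup (subgroupV decoG_subgroup (MG _ Mt)) (NG _ Ns)).
- by rewrite dpermM dpermV ts mulVg.
have es : s = t * a * b by rewrite -mulgA -eb mulVKg.
have Mta : M (t * a) by apply: (subgroupM sM).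
rewrite es (_ : b = 1) ?mulg1 //.
rewrite (_ : b = lab (dlab b)); last exact: deco_ext.
rewrite -lab1; congr lab; apply: funext => u; apply: funext => v.
have [/bM //|vM] := pselect (full M v).
have [uv|/eqP uv] := eqVneq (size u) (size v); last exact: (decoG_lab Gb).
apply/eqP/negPn/negP => /A5_centerless[e /eqP]; apply.
have cs : commute s (spot u v e).
  by apply: (normal_commute_spot nN) => // vN; apply/vM/fNM.
have ct : commute (t * a) (spot u v e) by apply: (normal_commute_spot nM).
have eb' : b = (t * a)^-1 * s by rewrite es mulKg.
have /commgP/eqP : commute b (spot u v e).
  rewrite eb'; apply/commute_sym/commuteM; last exact/commute_sym.
  exact/commuteV/commute_sym.
rewrite (_ : b = lab (dlab b)); last exact: deco_ext.
by rewrite labR_spot => /(congr1 (fun s => dlab s u v)); rewrite /= !eqxx.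
Qed.

(** * Counting subgroups *)

Lemma card_finType (X : finType) : ([set: X] #= `I_#|X|)%card.
Proof.
have rk : (enum_rank @` [set: X] #= [set: X])%card.
  by apply: inj_card_eq => x y _ _; apply: enum_rank_inj.
apply: card_eq_trans (card_esym rk) (card_esym _).
apply: card_eq_trans card_II _; rewrite (_ : _ @` _ = setT)%classic ?card_eqxx //.
by apply/seteqP; split=> // k _; exists (enum_val k); rewrite ?enum_valK.
Qed.

Lemma card_le_finType (T : Type) (A : set T) (X : finType) (f : T -> X) :
  {in A &, injective f} -> (A #<= `I_#|X|)%card.
Proof.
move=> /inj_card_eq fA; rewrite -(card_le_eqr (card_finType X)) -(card_le_eql fA).
exact: card_leT.
Qed.

Lemma card_ge_finType (T : Type) (A : set T) (X : finType) (f : X -> T) :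
  injective f -> (forall x, A (f x)) -> (`I_#|X| #<= A)%card.
Proof.
move=> finj fA; rewrite -(card_le_eql (card_finType X)).
have /card_le_eql<- : (f @` [set: X] #= [set: X])%card.
  by apply: inj_card_eq => x y _ _; apply: finj.
by apply: subset_card_le => _ [x _ <-]; apply: fA.
Qed.

Section Index.
Variables (G : groupType) (N : set G) (sN : is_subgroup N).

Lemma lcoset_eq x y : N (x^-1 * y) ->
  [set x * h | h in N]%classic = [set y * h | h in N]%classic.
Proof.
move=> Nxy; have Nyx : N (y^-1 * x).
  by rewrite -[_ * _]invgK invgM invgK; apply: (subgroupV sN).
apply/seteqP; split=> _ [h Nh <-].
  by exists (y^-1 * x * h); [apply: (subgroupM sN) | rewrite -mulgA mulVKg].
by exists (x^-1 * y * h); [apply: (subgroupM sN) | rewrite -mulgA mulVKg].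
Qed.

Lemma lcoset_eqP x y :
  [set x * h | h in N]%classic = [set y * h | h in N]%classic -> N (x^-1 * y).
Proof.
move=> e; have : [set y * h | h in N]%classic y.
  by exists 1; rewrite ?mulg1 //; apply: (subgroup1 sN).
by rewrite -e => -[h Nh <-]; rewrite mulKg.
Qed.

Lemma index_at_most_card n (X : finType) (phi : X -> G) : index_at_most N n ->
  (forall x y, N ((phi x)^-1 * phi y) -> x = y) -> #|X| <= n.
Proof.
move=> Nn inj; rewrite -card_le_II; apply: card_le_trans Nn.
apply: (@card_ge_finType _ _ _ (fun x => [set phi x * h | h in N]%classic)) => [x y|x].
  by move=> /lcoset_eqP/inj.
by exists (phi x).
Qed.

Lemma card_index_at_most n (X : finType) (phi : G -> X) : #|X| <= n ->
  (forall x y, phi x = phi y -> N (x^-1 * y)) -> index_at_most N n.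
Proof.
rewrite -card_le_II => Xn inj; apply: card_le_trans Xn.
pose rep (C : set G) := xget 1 C.
have repP C : lcosets_of N C -> C = [set rep C * h | h in N]%classic.
  move=> [x _ <-]; have [h Nh <-] : [set x * h | h in N]%classic (rep [set x * h | h in N]%classic).
    by apply: (@xgetPex _ 1); exists x; exists 1; rewrite ?mulg1 //; apply: (subgroup1 sN).
  by apply: lcoset_eq; rewrite mulKg.
apply: (@card_le_finType _ _ _ (phi \o rep)) => C D.
by move=> /set_mem/repP eC /set_mem/repP eD /inj/lcoset_eq; rewrite -eC -eD.
Qed.

End Index.

(** * The decorated group and its exchangeable layers *)

Definition decoGb : pred deco := fun s => `[< decoG s >].

Record gamma := Gamma { gval : deco; gvalP : decoGb gval }.
HB.instance Definition _ := [isSub for gval].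
HB.instance Definition _ := [Choice of gamma by <:].

Fact decoGb_closed : group_closed decoGb.
Proof.
split; first by apply/asboolP; apply: (subgroup1 decoG_subgroup).
by move=> s t /asboolP Gs /asboolP Gt; apply/asboolP; apply: (subgroupF decoG_subgroup).
Qed.
HB.instance Definition _ := SubChoice_isSubGroup.Build deco decoGb gamma decoGb_closed.

Definition toG (s : deco) : gamma := insubd 1 s.

Lemma toGK s : decoG s -> gval (toG s) = s.
Proof. by move=> Gs; apply: insubdK; apply/asboolP. Qed.

Lemma decoG_gval g : decoG (gval g).
Proof. exact/asboolP/gvalP. Qed.

Lemma gvalK g : toG (gval g) = g.
Proof. exact: valKd. Qed.

Lemma gval_inj : injective gval.
Proof. exact: val_inj. Qed.

Lemma gvalM g h : gval (g * h) = gval g * gval h. Proof. exact: valM. Qed.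
Lemma gval1 : gval 1 = 1. Proof. exact: val1. Qed.
Lemma gvalV g : gval g^-1 = (gval g)^-1.
Proof. by apply/esym/mulg1_eq; rewrite -gvalM mulgV gval1. Qed.
Lemma gvalJ g h : gval (g ^ h) = gval g ^ gval h.
Proof. by rewrite !conjgE !gvalM gvalV. Qed.

Lemma toGM s t : decoG s -> decoG t -> toG (s * t) = toG s * toG t.
Proof.
move=> Gs Gt; apply: gval_inj; rewrite gvalM !toGK //.
exact: (subgroupM decoG_subgroup).
Qed.

Lemma toGV s : decoG s -> toG s^-1 = (toG s)^-1.
Proof.
move=> Gs; apply: gval_inj; rewrite gvalV !toGK //.
exact: (subgroupV decoG_subgroup).
Qed.

Lemma gamma_finitely_generated : finitely_generated gamma.
Proof.
pose S := (toG @` (range (pure \o rooted) `|` range (pure \o directed)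
  `|` range (diag predT)))%classic.
exists S.
  by apply: finite_image; rewrite !finite_setU; split; [split|]; apply: finite_image;
    apply: finite_finset.
apply/seteqP; split=> // g _ P [sP SP].
suff [] : [set s | decoG s /\ P (toG s)]%classic (gval g) by rewrite gvalK.
apply: (decoG_ind _ _ _ _ (decoG_gval g)).
- have sG := decoG_subgroup; apply: subgroupI => [|s t [Gs Ps] [Gt Pt]|s [Gs Ps]].
  + split; first exact: (subgroup1 sG).
    rewrite (_ : toG 1 = 1); first exact: (subgroup1 sP).
    by apply: gval_inj; rewrite toGK ?gval1 //; apply: (subgroup1 sG).
  + by split; [apply: (subgroupM sG) | rewrite toGM //; apply: (subgroupM sP)].
  + by split; [apply: (subgroupV sG) | rewrite toGV //; apply: (subgroupV sP)].
- move=> a; split; first exact: decoG_pure (branch_rooted a).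
  by apply: SP; exists (pure (rooted a)) => //; left; left; exists a.
- move=> a; split; first exact: decoG_pure (branch_directed a).
  by apply: SP; exists (pure (directed a)) => //; left; right; exists a.
- move=> e; split; first exact: decoG_diagT.
  by apply: SP; exists (diag predT e) => //; right; exists e.
Qed.

Definition tau (v w x : word) : word :=
  if x == v then w else if x == w then v else x.

Lemma tauK v w : involutive (tau v w).
Proof.
move=> x; rewrite /tau.
have [->|xv] := eqVneq x v; first by rewrite eqxx; case: eqP.
have [->|xw] := eqVneq x w; first by rewrite eqxx.
by rewrite (negbTE xv) (negbTE xw).
Qed.

Definition swap_deco v w (s : deco) :=
  Deco (dperm s) (fun x y => dlab s x (tau v w y)).

(** Exchanging two layers of the same level changes finitely many labels only, so the
    result stays in the group. *)
Lemma decoG_swap v w s : size v = size w -> decoG s -> decoG (swap_deco v w s).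
Proof.
move=> vw Gs; rewrite -[swap_deco _ _ _](mulVKg s).
have sG := decoG_subgroup; apply: (subgroupM sG) => //.
rewrite (_ : _ * _ = lab (dlab (s^-1 * swap_deco v w s))); last first.
  by apply: deco_ext => //; rewrite dpermM dpermV mulVg.
apply: (@decoG_lab_finite (size v)) => x y; rewrite dlabM dlabV /= => xy.
have yv : size (tau v w y) = size y /\ size y <= size v.
  move: xy; rewrite /tau; have [->|_] := eqVneq y v; first by rewrite vw leqnn.
  have [->|_] := eqVneq y w; first by rewrite vw leqnn.
  by rewrite mulVg eqxx.
split; last by case: yv.
have sx : size ((dperm s)^-1 x) = size x.
  by apply: branch_size; apply: (subgroupV branch_subgroup); apply: decoG_perm.
apply/eqP; apply: contraNT xy => /eqP xy.
by rewrite !(decoG_lab Gs) ?invg1 ?mulg1 // sx // yv.1.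
Qed.

Definition swap v w (g : gamma) : gamma := toG (swap_deco v w (gval g)).

Section Swap.
Variables (v w : word) (vw : size v = size w).

Lemma gval_swap g : gval (swap v w g) = swap_deco v w (gval g).
Proof. by rewrite toGK //; apply: decoG_swap (decoG_gval g). Qed.

Lemma swapK : involutive (swap v w).
Proof.
move=> g; apply: gval_inj; rewrite !gval_swap; apply: deco_ext => // x y /=.
by rewrite tauK.
Qed.

Lemma swapM : {morph swap v w : g h / g * h}.
Proof.
move=> g h; apply: gval_inj; rewrite gvalM !gval_swap gvalM.
exact: deco_ext.
Qed.

Definition swap_aut : {multiplicative gamma -> gamma} :=
  HB.pack (swap v w) (isMultiplicative.Build _ _ (swap v w) swapM).

End Swap.

(** Subgroups of [gamma] as sets of elements of the ambient group [deco], where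
    they were analysed. *)
Definition gval_image (N : set gamma) : set deco := [set s | decoG s /\ N (toG s)]%classic.

Lemma gval_image_gval N g : gval_image N (gval g) <-> N g.
Proof. by rewrite /gval_image /= gvalK; split=> [[]|] //; split=> //; apply: decoG_gval. Qed.

Lemma gval_image_inj N M : (gval_image N `<=` gval_image M)%classic -> (N `<=` M)%classic.
Proof. by move=> NM g /gval_image_gval/NM/gval_image_gval. Qed.

Lemma gval_image_normal N : is_normal_subgroup N -> normal_in decoG (gval_image N).
Proof.
move=> [sN nN]; have sG := decoG_subgroup; split=> [|s []//|s t [Gs Ns] Gt].
- apply: subgroupI => [|s t [Gs Ns] [Gt Nt]|s [Gs Ns]].
  + by rewrite -gval1; apply/gval_image_gval; apply: (subgroup1 sN).
  + by split; [apply: (subgroupM sG) | rewrite toGM //; apply: (subgroupM sN)].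
  + by split; [apply: (subgroupV sG) | rewrite toGV //; apply: (subgroupV sN)].
- rewrite -(toGK Gs) -(toGK Gt) -gvalJ; apply/gval_image_gval.
  exact: nN.
Qed.

Lemma gval_image_index_le N n : is_normal_subgroup N -> index_at_most N n ->
  index_le (gval_image N) n.
Proof.
move=> [sN nN] Nn X phi Gphi inj.
apply: (index_at_most_card (phi := toG \o phi) sN Nn) => x y /= Nxy; apply: inj.
by rewrite -(toGK (Gphi x)) -(toGK (Gphi y)) -gvalV -gvalM; apply/gval_image_gval.
Qed.

Definition level N : nat :=
  xget 0 [set k | forall h, perm_image (gval_image N) h <-> branchG h /\ fixes_level h k]%classic.

Section FiniteIndex.
Variables (N : set gamma) (n : nat).
Hypotheses (nN : is_normal_subgroup N) (Nn : index_at_most N n).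

Lemma levelP h : perm_image (gval_image N) h <-> branchG h /\ fixes_level h (level N).
Proof.
have ex := perm_image_level (gval_image_normal nN) (gval_image_index_le nN Nn).
by move: h; apply: (@xgetPex _ 0 [set k | forall h, perm_image (gval_image N) h <->
  branchG h /\ fixes_level h k]%classic).
Qed.

Lemma level_index : 5 ^ level N <= n.
Proof.
exact: (perm_image_level_index (gval_image_index_le nN Nn) levelP).
Qed.

Lemma gval_image_layer_index v : ~ full (gval_image N) v -> 2 ^ (5 ^ size v) <= n.
Proof. exact: (layer_index (gval_image_normal nN) (gval_image_index_le nN Nn)). Qed.

End FiniteIndex.

Lemma normal_subgroup_eq N M n : is_normal_subgroup N -> index_at_most N n ->
  is_normal_subgroup M -> index_at_most M n ->
  (forall v, full (gval_image N) v <-> full (gval_image M) v) -> level N = level M -> N = M.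
Proof.
move=> nN Nn nM Mn NM lNM.
apply/seteqP; split; apply: gval_image_inj.
- apply: (normal_determined (gval_image_normal nN) (gval_image_normal nM)
    (gval_image_index_le nN Nn) (gval_image_index_le nM Mn) NM) => h.
  by move=> /(levelP nN Nn); rewrite lNM => /(levelP nM Mn).
- apply: (normal_determined (gval_image_normal nM) (gval_image_normal nN)
    (gval_image_index_le nM Mn) (gval_image_index_le nN Nn)) => [v|h].
    by rewrite NM.
  by move=> /(levelP nM Mn); rewrite -lNM => /(levelP nN Nn).
Qed.

Definition normal_subgroups n : set (set gamma) :=
  [set N | is_normal_subgroup N /\ index_at_most N n]%classic.

(** The layers of words longer than [n] are full, by the index bound. *)
Lemma normal_subgroups_finite n : finite_set (normal_subgroups n).
Proof.
pose r := words_upto n.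
pose code N := ([ffun i : 'I_(size r) => `[< full (gval_image N) (nth [::] r i) >]],
  inord (level N) : 'I_n.+1).
suff codeP : {in normal_subgroups n &, injective code}.
  exact: card_le_finite (card_le_finType codeP) (finite_II _).
move=> N M /set_mem[nN Nn] /set_mem[nM Mn] [/ffunP ef el].
apply: (normal_subgroup_eq nN Nn nM Mn) => [v|].
- have [vn|nv] := leqP (size v) n.
    have vr := mem_words_upto vn; rewrite -index_mem in vr.
    have := ef (Ordinal vr); rewrite !ffunE /= nth_index -?index_mem // => e.
    by split=> vF; apply/asboolP; [rewrite -e | rewrite e]; apply/asboolP.
  have big : n < 2 ^ (5 ^ size v).
    apply: (ltn_trans nv); apply: (ltn_trans (ltn_expl (size v) (isT : 1 < 5))).
    exact: ltn_expl.
  by split=> _; apply: contrapT;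
    [move=> /(gval_image_layer_index nM Mn) | move=> /(gval_image_layer_index nN Nn)];
    rewrite leqNgt big.
- have ltl P : is_normal_subgroup P -> index_at_most P n -> level P < n.+1.
    move=> nP /(level_index nP) Pn; rewrite ltnS; apply: leq_trans Pn.
    exact/ltnW/ltn_expl.
  by rewrite -(inordK (ltl N nN Nn)) el inordK // ltl.
Qed.

(** * Characteristic subgroups are few *)

Lemma conj_morph (y : gamma) : {morph (fun x => x ^ y) : a b / a * b}.
Proof. by move=> a b; rewrite conjMg. Qed.

Definition conj_aut (y : gamma) : {multiplicative gamma -> gamma} :=
  HB.pack (fun x : gamma => x ^ y)
    (isMultiplicative.Build _ _ (fun x : gamma => x ^ y) (conj_morph y)).

Lemma characteristic_normal (N : set gamma) :
  is_characteristic_subgroup N -> is_normal_subgroup N.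
Proof.
move=> [sN cN]; split=> // x y Nx.
rewrite -(cN (conj_aut y)); first by exists x.
by exists (fun x => x ^ y^-1); [apply: conjgK | apply: conjgKV].
Qed.

Lemma swap_spot v w u e : size v = size w -> size u = size v ->
  swap v w (toG (spot u v e)) = toG (spot u w e).
Proof.
move=> vw uv; apply: gval_inj; rewrite (gval_swap vw) !toGK.
- apply: deco_ext => // x y; rewrite [LHS]/=.
  have tv : tau v w v = w by rewrite /tau eqxx.
  rewrite (_ : (tau v w y == v) = (y == w)) //.
  by rewrite -(inj_eq (can_inj (tauK v w))) tauK tv.
- by apply: decoG_spot; rewrite uv.
- exact: decoG_spot.
Qed.

Lemma characteristic_full N v w : is_characteristic_subgroup N -> size v = size w ->
  full (gval_image N) v -> full (gval_image N) w.
Proof.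
move=> [sN cN] vw vN u e uw; split; first exact: decoG_spot.
rewrite -(swap_spot e vw); last by rewrite uw.
rewrite -(cN (swap_aut vw)); last by exists (swap v w); apply: swapK.
exists (toG (spot u v e)) => //.
by have [] := vN u e (etrans uw (esym vw)).
Qed.

(** A characteristic subgroup treats all layers of a level alike, so one bit for
    each of the first [L] levels records which layers are full; by the index bound
    all layers of the other levels are. *)
Lemma characteristic_growth_le n L K : (forall l, 2 ^ (5 ^ l) <= n -> l < L) ->
  (forall k, 5 ^ k <= n -> k <= K) -> characteristic_growth gamma n <= 2 ^ L * K.+1.
Proof.
move=> nL nK.
pose code N := ([ffun i : 'I_L => `[< full (gval_image N) (nseq i l0) >]],
  inord (level N) : 'I_K.+1).
suff codeP : {in [set N | is_characteristic_subgroup N /\ index_at_most N n]%classic &,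
    injective code}.
  have := geq_card_fset_set (card_le_finType codeP).
  by rewrite card_prod card_ffun card_bool !card_ord.
move=> N M /set_mem[cN Nn] /set_mem[cM Mn] [/ffunP ef el].
have nN := characteristic_normal cN; have nM := characteristic_normal cM.
apply: (normal_subgroup_eq nN Nn nM Mn) => [v|].
- have fullE P : is_characteristic_subgroup P ->
      full (gval_image P) v <-> full (gval_image P) (nseq (size v) l0).
    by move=> cP; split; apply: characteristic_full; rewrite ?size_nseq.
  have [vL|Lv] := ltnP (size v) L.
    have := ef (Ordinal vL); rewrite !ffunE /= => e.
    by split=> /fullE vF; apply/fullE/asboolP => //; [rewrite -e | rewrite e]; apply/asboolP/vF.
  by split=> _; apply: contrapT;
    [move=> /(gval_image_layer_index nM Mn) | move=> /(gval_image_layer_index nN Nn)];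
    move=> /nL; rewrite ltnNge Lv.
- have ltl P : is_normal_subgroup P -> index_at_most P n -> level P < K.+1.
    by move=> nP /(level_index nP)/nK.
  by rewrite -(inordK (ltl N nN Nn)) el inordK // ltl.
Qed.

(** * Normal subgroups are many *)

Section LevelSubgroups.
Variable i : nat.
Notation word_i := (i.-tuple letter).

(** The kernel of the action of [gamma] on the words of length [i] and on the
    labels, at such words, in the layers of [F]. *)
Definition level_subgroup (F : {set word_i}) : set gamma :=
  [set g | fixes_level (dperm (gval g)) i /\
    forall (u : word) (t : word_i), size u = i -> t \in F -> dlab (gval g) u t = 1]%classic.

Lemma gamma_size g u : size (dperm (gval g) u) = size u.
Proof. exact: branch_size (decoG_perm (decoG_gval g)). Qed.

Lemma gamma_sizeV g u : size ((dperm (gval g))^-1 u) = size u.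
Proof. by rewrite -dpermV -gvalV gamma_size. Qed.

Lemma level_subgroup_normal F : is_normal_subgroup (level_subgroup F).
Proof.
split=> [|g h [gi gF]].
- apply: subgroupI => [|g h [gi gF] [hi hF]|g [gi gF]].
  + by split=> [u|u t]; rewrite gval1.
  + split=> [u ui|u t ui tF]; first by rewrite gvalM dpermM symM gi ?hi.
    by rewrite gvalM dlabM gF // gi // hF // mulg1.
  + split=> [u ui|u t ui tF]; first by rewrite gvalV dpermV; apply/symV/gi.
    by rewrite gvalV dlabV gF ?invg1 // gamma_sizeV.
- have gi' u : size u = i -> dperm (gval g) ((dperm (gval h))^-1 u) = (dperm (gval h))^-1 u.
    by move=> ui; apply: gi; rewrite gamma_sizeV.
  split=> [u ui|u t ui tF].
    by rewrite gvalJ conjgE !dpermM dpermV !symM gi' // symVK.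
  rewrite gvalJ conjgE !dlabM dlabV dpermV gi' // gF ?gamma_sizeV //.
  by rewrite mul1g mulVg.
Qed.

Lemma level_subgroup_index F n :
  #|{: {ffun word_i -> word_i} * {ffun word_i * word_i -> A5}}| <= n ->
  index_at_most (level_subgroup F) n.
Proof.
have [sF _] := level_subgroup_normal F.
pose code g : {ffun word_i -> word_i} * {ffun word_i * word_i -> A5} :=
  ([ffun u : word_i => insubd u (dperm (gval g) u)],
   [ffun p : word_i * word_i => dlab (gval g) p.1 p.2]).
move=> cardX; apply: (card_index_at_most (phi := code) sF cardX) => g h.
move=> [/ffunP ep /ffunP el].
have ep' u : size u = i -> dperm (gval g) u = dperm (gval h) u.
  move=> ui; have := ep (Tuple (introT eqP ui)); rewrite !ffunE => /(congr1 val).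
  by rewrite !insubdK //= unfold_in /= gamma_size ui.
have el' u (t : word_i) : size u = i -> dlab (gval g) u t = dlab (gval h) u t.
  by move=> ui; have := el (Tuple (introT eqP ui), t); rewrite !ffunE.
split=> [u ui|u t ui tF].
  by rewrite gvalM gvalV dpermM dpermV symM -ep' ?gamma_sizeV // symVK.
by rewrite gvalM gvalV dlabM dlabV el' ?gamma_sizeV // mulVg.
Qed.

Lemma spot_level_subgroup e F (t : word_i) : e != 1 ->
  level_subgroup F (toG (spot t t e)) <-> t \notin F.
Proof.
move=> e1; rewrite /level_subgroup /= toGK; last exact: decoG_spot.
split=> [[_ tF]|tF].
  apply/negP => /(tF t t (size_tuple t)) /=.
  by rewrite eqxx /= => e0; rewrite e0 eqxx in e1.
split=> // u t' _ t'F /=; rewrite ifF //; apply/negP => /andP[_ /eqP/val_inj tt'].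
by rewrite -tt' t'F in tF.
Qed.

Lemma level_subgroup_inj : injective level_subgroup.
Proof.
have [a [b ab]] := A5_noncommuting.
move=> F F' e; apply/setP => t; apply: negb_inj; apply/idP/idP.
  by move=> /(spot_level_subgroup _ _ ab); rewrite e => /(spot_level_subgroup _ _ ab).
by move=> /(spot_level_subgroup _ _ ab); rewrite -e => /(spot_level_subgroup _ _ ab).
Qed.

(** Any set of layers of level [i] yields a different normal subgroup, while one
    bound serves for the index of them all. *)
Lemma normal_growth_ge n :
  #|{: {ffun word_i -> word_i} * {ffun word_i * word_i -> A5}}| <= n ->
  2 ^ (5 ^ i) <= normal_growth gamma n.
Proof.
move=> cardX; apply: leq_card_fset_set; first exact: normal_subgroups_finite.
have -> : (2 ^ (5 ^ i))%N = #|{: {set word_i}}|.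
  by rewrite -cardsT -powersetT card_powerset cardsT card_tuple card_ord.
apply: (card_ge_finType level_subgroup_inj) => F.
by split; [apply: level_subgroup_normal | apply: level_subgroup_index].
Qed.

End LevelSubgroups.

(** * Comparison of the two growths *)
Local Close Scope group_scope.

Lemma card_A5_le : #|{: A5}| <= 2 ^ 7.
Proof.
apply: leq_trans (leq_card (sgval : A5 -> {perm letter}) val_inj) _.
by rewrite -cardsT (@alt.card_Sym letter) card_ord.
Qed.

Lemma normal_growth_lower i n : 2 ^ (25 ^ i.+1) <= n -> 2 ^ (5 ^ i) <= normal_growth gamma n.
Proof.
move=> in_n; apply/normal_growth_ge/(leq_trans _ in_n).
rewrite card_prod !card_ffun card_prod !card_tuple !card_ord.
apply: (@leq_trans (2 ^ (3 * i * 5 ^ i) * 2 ^ (7 * (5 ^ i * 5 ^ i)))).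
  apply: leq_mul.
    (* 5 <= 2 ^ 3 *)
    rewrite [2 ^ _]expnM leq_exp2r ?expn_gt0 // expnM.
    by case: i {in_n} => // i; rewrite leq_exp2r.
  by rewrite [2 ^ _]expnM leq_exp2r ?muln_gt0 ?expn_gt0 // card_A5_le.
rewrite -expnD leq_exp2l // expnS -[25]/(5 * 5) expnMn.
have : i < 5 ^ i by apply: ltn_expl.
by move: (5 ^ i) => x ix; nia.
Qed.

Lemma characteristic_growth_upper j n : n < 2 ^ (25 ^ j.+1) ->
  characteristic_growth gamma n <= 2 ^ (8 * j.+1).
Proof.
rewrite -[25]/(5 ^ 2) -expnM => nj.
apply: leq_trans (characteristic_growth_le (L := 2 * j.+1) (K := 5 ^ (2 * j.+1)) _ _) _.
- move=> l /leq_ltn_trans/(_ nj).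
  by rewrite ltn_exp2l // ltn_exp2l.
- move=> k kn; apply/ltnW; rewrite -(@ltn_exp2l 2) //.
  by apply: leq_ltn_trans (leq_ltn_trans kn nj); case: k {kn} => // k; rewrite leq_exp2r.
have -> : 8 * j.+1 = 2 * j.+1 + 3 * (2 * j.+1) by lia.
rewrite expnD leq_mul2l (expnM 2 3); apply/orP; right.
by rewrite ltn_exp2r // muln_gt0.
Qed.

(** The normal growth eventually exceeds every power of the characteristic growth. *)
Lemma growth_gap p : exists n0, forall n, n0 <= n ->
  characteristic_growth gamma n ^ p < normal_growth gamma n.
Proof.
exists (2 ^ (25 ^ (16 * p).+1)) => n n_big.
have n0 : 0 < n by apply: leq_trans n_big; rewrite expn_gt0.
(* The level [i] satisfies 25 ^ (i + 1) <= log2 n < 25 ^ (i + 2). *)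
pose m := trunc_log 2 n.
have pm : 25 ^ (16 * p).+1 <= m by rewrite trunc_log_max.
have m0 : 0 < m by apply: leq_trans pm; rewrite expn_gt0.
have /andP[jm mj] := trunc_log_bounds (isT : 1 < 25) m0.
have pj : 16 * p < trunc_log 25 m by apply: trunc_log_max.
case: (trunc_log 25 m) pj jm mj => // i; rewrite ltnS => pi im mi.
have lower := @normal_growth_lower i n.
have upper := @characteristic_growth_upper i.+1 n.
have {}lower : 2 ^ (5 ^ i) <= normal_growth gamma n.
  apply: lower; apply: leq_trans (trunc_logP (isT : 1 < 2) n0).
  by rewrite leq_exp2l.
have {}upper : characteristic_growth gamma n <= 2 ^ (8 * i.+2).
  by apply: upper; apply: leq_trans (trunc_log_ltn n (isT : 1 < 2)) _; rewrite leq_exp2l.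
apply: leq_trans lower.
case: p {n_big pm} pi => [|p] pi.
  by rewrite expn0 (@ltn_exp2l 2 0) // expn_gt0.
apply: (@leq_ltn_trans ((2 ^ (8 * i.+2)) ^ p.+1)); first by rewrite leq_exp2r.
rewrite -expnM ltn_exp2l //.
(* 8 (i + 2) (p + 1) < (i + 1) ^ 2 <= 4 ^ i <= 5 ^ i as 16 (p + 1) <= i. *)
have i2 : i < 2 ^ i by apply: ltn_expl.
have e4 : 2 ^ i * 2 ^ i <= 5 ^ i.
  by rewrite -expnMn; case: (i) => // k; rewrite leq_exp2r.
apply: leq_trans e4.
by move: (2 ^ i) i2 => x; nia.
Qed.


Import Order.TTheory GRing.Theory Num.Theory.
Local Open Scope ring_scope.

(** If [g <= f ^ a] everywhere and [f ^ b <= h] infinitely often, then infinitely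
    often [g <= f ^ a <= f ^ (b * p) <= h ^ p] for any [p >= a / b]; here [1 <= f]
    because [1 <= g <= f ^ a]. *)
Lemma growth_type_gap (R : realType) (g h : nat -> nat) :
  (forall p, exists n0, forall n, (n0 <= n)%N -> (h n ^ p < g n)%N) ->
  ~ exists f : nat -> R, [/\ forall n, (0 < n)%N -> 0 < f n,
      has_growth_type (fun n => (g n)%:R) f & has_growth_type (fun n => (h n)%:R) f].
Proof.
move=> gap [f [f0 [a [_ [a0 _ ga _]]] [_ [b [_ b0 _ hb]]]]].
have [n0 gapn] := gap (Num.bound (a / b)).
have [n [[n_gt0 fh] n0n]] : exists n, ((0 < n)%N /\ f n `^ b <= (h n)%:R) /\ (n0 <= n)%N.
  apply: contrapT => no; apply: hb; apply: sub_finite_set (finite_II n0) => n [n_gt0 fh].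
  by rewrite /= ltnNge; apply/negP => n0n; apply: no; exists n.
have {}gapn := gapn n n0n; have {}ga := ga n n_gt0; have {}f0 := f0 n n_gt0.
have f1 : 1 <= f n.
  rewrite leNgt; apply/negP => f_lt1.
  have : (1 : R) <= f n `^ a by apply: le_trans ga; rewrite ler1n (leq_trans _ gapn).
  have e1 : (1 : R) `^ a = 1 by rewrite powR1.
  by rewrite leNgt -[ltRHS]e1 gt0_ltr_powR // nnegrE ?ler01 // ltW.
have : f n `^ a <= (h n ^ Num.bound (a / b))%:R.
  apply: (@le_trans _ _ (f n `^ (b * (Num.bound (a / b))%:R))).
    rewrite ler_powR // -ler_pdivrMl // mulrC.
    by apply/ltW/archi_boundP/divr_ge0; apply: ltW.
  rewrite powRrM powR_mulrn ?powR_ge0 // natrX.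
  by rewrite lerXn2r // nnegrE ?powR_ge0.
by move=> /(le_trans ga); rewrite ler_nat leqNgt gapn.
Qed.

Theorem proposition1p3 (R : realType) :
  exists G : groupType, finitely_generated G /\
    ~ exists f : nat -> R,
        [/\ forall n, (0 < n)%N -> (0 < f n)%R,
            has_growth_type (fun n => (normal_growth G n)%:R%R) f &
            has_growth_type (fun n => (characteristic_growth G n)%:R%R) f].
Proof.
exists gamma; split; first exact: gamma_finitely_generated.
exact: growth_type_gap growth_gap.
Qed.
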